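(* Let $\nu>0$ be real with $\nu\notin\mathbb{Z}$, and let $z\in\mathbb{C}$, $z\neq 0$, $|\arg z|<\pi$. Then $$\frac{\partial I_\nu(z)}{\partial\nu}=I_\nu(z)\left[\frac{z^2}{4(1-\nu^2)}\,{}_3F_4\left(\left.\begin{array}{c}1,\ 1,\ \frac32\\ 2,\ 2,\ 2-\nu,\ 2+\nu\end{array}\right|z^2\right)+\log\left(\frac z2\right)-\psi(\nu)-\frac1{2\nu}\right]-I_{-\nu}(z)\,\frac{\pi\csc(\pi\nu)}{2\,\Gamma^2(\nu+1)}\left(\frac z2\right)^{2\nu}{}_2F_3\left(\left.\begin{array}{c}\nu,\ \frac12+\nu\\ 1+\nu,\ 1+\nu,\ 1+2\nu\end{array}\right|z^2\right).$$
   Context: Powers and logarithms take their principal values. $I_\nu(z)=(z/2)^\nu\sum_{k\ge0}\frac{(z/2)^{2k}}{k!\,\Gamma(\nu+k+1)}$ is the modified Bessel function; $\partial/\partial\nu$ is the derivative with respect to the order at fixed $z$. $\psi=\Gamma'/\Gamma$ is the digamma function. The generalized hypergeometric function is ${}_pF_q\left(\left.\begin{array}{c}a_1,\dots,a_p\\ b_1,\dots,b_q\end{array}\right|x\right)=\sum_{k\ge0}\frac{(a_1)_k\cdots(a_p)_k}{(b_1)_k\cdots(b_q)_k}\frac{x^k}{k!}$ with $(\alpha)_k=\Gamma(\alpha+k)/\Gamma(\alpha)$ (i.e. $(\alpha)_k=\alpha(\alpha+1)\cdots(\alpha+k-1)$). *)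

(* Defs.v *)
From Stdlib Require Import Reals ZArith List.
From Coquelicot Require Import Coquelicot.
Import ListNotations.

Open Scope R_scope.

(* Rising factorial (a)_k = a (a+1) ... (a+k-1). *)
Fixpoint poch (a : R) (k : nat) : R :=
  match k with
  | O => 1
  | S k' => poch a k' * (a + INR k')
  end.

(* Euler's integral; meaningful for x > 0. *)
Definition Gamma_int (x : R) : R :=
  RInt_gen (fun t => Rpower t (x - 1) * exp (- t))
           (at_right 0) (Rbar_locally p_infty).

(* Gamma on R minus {0, -1, -2, ...}, continued by Gamma (x+n) = (x)_n Gamma x.
   The shift n is the least natural number with x + n > 0, so n = 0 and
   Gamma x = Gamma_int x when x > 0.  The value at a pole is junk. *)
Definition Gamma (x : R) : R :=
  let n := Z.to_nat (up (- x)) in Gamma_int (x + INR n) / poch x n.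

Definition digamma (x : R) : R := Derive Gamma x / Gamma x.

Definition Cexp (z : C) : C :=
  (exp (Re z) * cos (Im z), exp (Re z) * sin (Im z)).

(* Principal argument, in (-PI, PI] for z <> 0. *)
Definition Arg (z : C) : R :=
  if Rle_dec 0 (Im z) then acos (Re z / Cmod z) else - acos (Re z / Cmod z).

Definition Clog (z : C) : C := (ln (Cmod z), Arg z).

(* Principal power z^s, for z <> 0. *)
Definition Cpower (z s : C) : C := Cexp (s * Clog z)%C.

(* Sum of a complex series; junk, like [Series], if the series diverges. *)
Definition CSeries (a : nat -> C) : C :=
  (Series (fun k => Re (a k)), Series (fun k => Im (a k))).

Definition BesselI (nu : R) (z : C) : C :=
  (Cpower (z / 2) nu *
   CSeries (fun k =>
     (z / 2) ^ (2 * k) / RtoC (INR (fact k) * Gamma (nu + INR k + 1))))%C.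

Definition poch_prod (l : list R) (k : nat) : R :=
  fold_right (fun a p => poch a k * p) 1 l.

(* pFq with p = length a, q = length b; the parameters are real, the argument
   is complex. *)
Definition hypergeom (a b : list R) (x : C) : C :=
  CSeries (fun k =>
    (RtoC (poch_prod a k / poch_prod b k) * (x ^ k / RtoC (INR (fact k))))%C).

(* Main.v *)
Require Import Defs.
From Stdlib Require Import Reals ZArith List Lra Lia FunctionalExtensionality.
From Coquelicot Require Import Coquelicot.
Import ListNotations.
Open Scope R_scope.

(** Put t = (z/2)^2 and let a, b be the coefficient sequences 1 / (k! (1 +- nu)_k), so that
    I_nu and I_(-nu) are (z/2)^(+-nu) / Gamma(1 +- nu) times the series of a and b in t.  As
    Gamma(nu+k+1) = (nu+1)_k Gamma(nu+1), differentiation in the order leaves the digamma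
    function and the series of u_k = - a_k sum_(j<=k) 1/(nu+j).  With theta = t d/dt, u solves
    the inhomogeneous Bessel equation (theta^2 + nu theta - t) u = - theta a.  Variation of
    constants gives another solution a (c - 1/(2 nu)) - b d / (2 nu), where
    theta c = (a b - 1)/2 and (theta + nu) d = nu a^2, and it has the same constant term.  The
    Chu-Vandermonde identity evaluates the coefficients of a b and a^2, which identifies c and
    d with the 3F4 and 2F3 of the statement.  The factor pi csc(pi nu) enters through the
    reflection formula.

    For Gamma, a pointwise AM-GM inequality under Euler's integral gives
    Gamma(x+s) <= x^s Gamma(x) for 0 <= s <= 1.  It controls the increments of ln Gamma far
    out, and through the functional equation it yields both the differentiability of Gamma and
    Gauss' limit; the latter reduces the reflection formula to the sine product, obtained from
    the moments of cos(2 s t) cos(t)^n on [0, pi/2]. *)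

(** * Formal power series and the Bessel recurrence *)

Definition seq_add (a b : nat -> R) (n : nat) : R := a n + b n.
Definition seq_opp (a : nat -> R) (n : nat) : R := - a n.
Definition seq_sub (a b : nat -> R) (n : nat) : R := a n - b n.
Definition seq_const (c : R) (n : nat) : R := match n with O => c | S _ => 0 end.
Definition shift (a : nat -> R) (n : nat) : R := a (S n).

(* Cauchy product, in a form on which ring identities are proved by induction on the index. *)
Fixpoint conv (a b : nat -> R) (n : nat) : R :=
  match n with
  | O => a O * b O
  | S m => a O * b (S m) + conv (shift a) b m
  end.

(** A sequence stands for the formal power series in t with these coefficients; this one is t
    itself, so multiplying by it shifts the index. *)
Definition seq_X : nat -> R := fun n => match n with 1%nat => 1 | _ => 0 end.
Definition theta (a : nat -> R) (n : nat) : R := INR n * a n.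

Lemma conv_add_l a b c n : conv (seq_add a b) c n = conv a c n + conv b c n.
Proof.
  revert a b; induction n as [|n IH]; intros a b; simpl; unfold seq_add.
  - ring.
  - change (shift (fun n0 => a n0 + b n0)) with (seq_add (shift a) (shift b)).
    rewrite IH; ring.
Qed.

Lemma conv_scal_l (k : R) a c n : conv (fun m => k * a m) c n = k * conv a c n.
Proof.
  revert a; induction n as [|n IH]; intros a; simpl.
  - ring.
  - change (shift (fun m => k * a m)) with (fun m => k * shift a m).
    rewrite IH; ring.
Qed.

Lemma conv_rec_r a b n : conv a b (S n) = a (S n) * b O + conv a (shift b) n.
Proof.
  revert a; induction n as [|n IH]; intros a.
  - simpl; unfold shift; ring.
  - change (conv a b (S (S n))) with (a O * b (S (S n)) + conv (shift a) b (S n)).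
    rewrite IH; simpl; unfold shift; ring.
Qed.

Lemma conv_comm a b n : conv a b n = conv b a n.
Proof.
  revert a b; induction n as [|n IH]; intros a b.
  - simpl; ring.
  - rewrite conv_rec_r; simpl; rewrite IH; ring.
Qed.

Lemma shift_conv a b :
  shift (conv a b) = seq_add (fun m => a O * shift b m) (conv (shift a) b).
Proof. reflexivity. Qed.

Lemma conv_assoc a b c n : conv a (conv b c) n = conv (conv a b) c n.
Proof.
  revert a b; induction n as [|n IH]; intros a b.
  - simpl; ring.
  - simpl. rewrite shift_conv, conv_add_l, conv_scal_l, IH; ring.
Qed.

Lemma conv_zero_l a n : conv (seq_const 0) a n = 0.
Proof.
  revert a; induction n as [|n IH]; intros a; simpl.
  - ring.
  - replace (shift (seq_const 0)) with (seq_const 0); [rewrite IH; ring|].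
    now apply functional_extensionality; intros [|m].
Qed.

Lemma conv_const_l (k : R) a n : conv (seq_const k) a n = k * a n.
Proof.
  destruct n as [|n]; simpl; [ring|].
  replace (shift (seq_const k)) with (seq_const 0).
  - rewrite conv_zero_l; ring.
  - now apply functional_extensionality; intros [|m].
Qed.

Lemma conv_X_S a n : conv seq_X a (S n) = a n.
Proof.
  simpl. replace (shift seq_X) with (seq_const 1).
  - rewrite conv_const_l; ring.
  - now apply functional_extensionality; intros [|m].
Qed.

(** Registered with [Add Ring], this lets [ring] compute with formal power series as a whole; the
    differential equations below then become polynomial identities in which [theta a], [theta b] are
    atoms. *)
Lemma seq_ring_theory :
  ring_theory (seq_const 0) (seq_const 1) seq_add conv seq_sub seq_opp eq.
Proof.
  split; intros; apply functional_extensionality; intros n.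
  - destruct n; unfold seq_add; simpl; ring.
  - unfold seq_add; ring.
  - unfold seq_add; ring.
  - rewrite conv_const_l; ring.
  - apply conv_comm.
  - apply conv_assoc.
  - apply conv_add_l.
  - reflexivity.
  - destruct n; unfold seq_add, seq_opp; simpl; ring.
Qed.

Add Ring seq_ring : seq_ring_theory.

Lemma theta_add a b : theta (seq_add a b) = seq_add (theta a) (theta b).
Proof.
  apply functional_extensionality; intros n; unfold theta, seq_add; ring.
Qed.

Lemma theta_sub a b : theta (seq_sub a b) = seq_sub (theta a) (theta b).
Proof.
  apply functional_extensionality; intros n; unfold theta, seq_sub; ring.
Qed.

Lemma theta_const k : theta (seq_const k) = seq_const 0.
Proof.
  apply functional_extensionality; intros [|n]; unfold theta; simpl; ring.
Qed.

Lemma shift_theta a : shift (theta a) = seq_add (shift a) (theta (shift a)).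
Proof.
  apply functional_extensionality; intros n; unfold theta, shift, seq_add.
  rewrite S_INR; ring.
Qed.

(** Leibniz rule: t d/dt is a derivation. The induction removes the leading coefficient of a, and
    [shift_theta] accounts for the index being off by one after the shift. *)
Lemma theta_conv a b :
  theta (conv a b) = seq_add (conv (theta a) b) (conv a (theta b)).
Proof.
  apply functional_extensionality; intros n; unfold seq_add.
  revert a b; induction n as [|n IH]; intros a b.
  - unfold theta; simpl; ring.
  - simpl conv. rewrite shift_theta, conv_add_l.
    replace (theta (conv a b) (S n))
      with (INR (S n) * (a O * b (S n)) + (conv (shift a) b n + theta (conv (shift a) b) n)).
    + rewrite IH; unfold theta; rewrite S_INR; simpl; ring.
    + unfold theta; rewrite S_INR; simpl; ring.
Qed.

(** Coefficients of 0F1(; al + 1; t). At t = (z/2)^2 this series is Gamma(al + 1) (z/2)^(-al)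
    I_al(z). *)
Definition bessel_coef (al : R) (k : nat) : R := / (INR (fact k) * poch (al + 1) k).

Lemma poch_neq_0 a k : (forall j, (j < k)%nat -> a + INR j <> 0) -> poch a k <> 0.
Proof.
  induction k as [|k IH]; intros H; simpl; [lra|].
  apply Rmult_integral_contrapositive; split; auto.
Qed.

(* al is not a negative integer, so that no [poch (al + 1) k] vanishes. *)
Definition non_negint (al : R) : Prop := forall n : nat, al + 1 + INR n <> 0.

Lemma bessel_coef_S al k : non_negint al ->
  INR (S k) * (INR (S k) + al) * bessel_coef al (S k) = bessel_coef al k.
Proof.
  intros H; unfold bessel_coef.
  change (fact (S k)) with (S k * fact k)%nat; rewrite mult_INR; simpl poch.
  assert (H1 := INR_fact_neq_0 k).
  assert (H2 : INR (S k) <> 0) by (apply not_0_INR; lia).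
  assert (H3 : poch (al + 1) k <> 0) by (apply poch_neq_0; auto).
  assert (H4 := H k). rewrite S_INR in *. field. repeat split; auto; lra.
Qed.

(** The two-term recurrence, read as the equation (theta^2 + al theta - t) y = 0. It serves for the
    orders nu and -nu alike. *)
Lemma bessel_ode al : non_negint al ->
  seq_add (theta (theta (bessel_coef al)))
    (conv (seq_const al) (theta (bessel_coef al)))
  = conv seq_X (bessel_coef al).
Proof.
  intros H; apply functional_extensionality; intros [|k].
  - unfold seq_add, theta; simpl; ring.
  - rewrite conv_X_S, <- (bessel_coef_S al k H).
    unfold seq_add; rewrite conv_const_l; unfold theta; ring.
Qed.

Lemma theta_eq_const (c : nat -> R) : theta c = seq_const 0 -> c = seq_const (c O).
Proof.
  intros H; apply functional_extensionality; intros [|n]; [reflexivity|].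
  apply (f_equal (fun f => f (S n))) in H; unfold theta in H; simpl seq_const in *.
  apply Rmult_integral in H; destruct H as [H|H]; [|exact H].
  exfalso; revert H; apply not_0_INR; lia.
Qed.

(** The left side is the Wronskian, with respect to theta, of t^(al/2) a and t^(-al/2) b. By the two
    Bessel equations its theta-derivative vanishes, so it equals its constant term al. *)
Lemma bessel_wronskian al : non_negint al -> non_negint (- al) ->
  let a := bessel_coef al in let b := bessel_coef (- al) in
  seq_add (seq_sub (conv b (theta a)) (conv a (theta b)))
    (conv (seq_const al) (conv a b)) = seq_const al.
Proof.
  intros Ha Hb a b.
  assert (Ea := bessel_ode al Ha); assert (Eb := bessel_ode (- al) Hb).
  fold a in Ea; fold b in Eb.
  replace (seq_const (- al)) with (seq_opp (seq_const al)) in Eb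
    by (apply functional_extensionality; intros [|n]; unfold seq_opp; simpl; ring).
  assert (Ea' : theta (theta a)
      = seq_sub (conv seq_X a) (conv (seq_const al) (theta a)))
    by (rewrite <- Ea; ring).
  assert (Eb' : theta (theta b)
      = seq_add (conv seq_X b) (conv (seq_const al) (theta b)))
    by (rewrite <- Eb; ring).
  rewrite theta_eq_const at 1.
  - f_equal. unfold seq_add, seq_sub, theta, a, b, bessel_coef; simpl. field.
  - rewrite theta_add, theta_sub, !theta_conv, theta_const, Ea', Eb'. ring.
Qed.

Lemma conv_PS_mult a b n : conv a b n = PS_mult a b n.
Proof.
  unfold PS_mult; revert a; induction n as [|n IH]; intros a.
  - reflexivity.
  - rewrite decomp_sum by lia. simpl conv; rewrite IH, Nat.sub_0_r; reflexivity.
Qed.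

(** * Binomial series and the Chu-Vandermonde identity *)

Fixpoint falling (x : R) (k : nat) : R :=
  match k with O => 1 | S j => falling x j * (x - INR j) end.

Definition binom_coef (x : R) (k : nat) : R := falling x k / INR (fact k).

(** This is (1 + t) y' = x y, the equation of (1 + t)^x, multiplied by t. *)
Lemma binom_ode x :
  seq_add (theta (binom_coef x)) (conv seq_X (theta (binom_coef x)))
  = conv seq_X (conv (seq_const x) (binom_coef x)).
Proof.
  apply functional_extensionality; intros [|n]; unfold seq_add.
  - unfold theta; simpl; ring.
  - rewrite !conv_X_S, conv_const_l; unfold theta, binom_coef.
    change (fact (S n)) with (S n * fact n)%nat; rewrite mult_INR; simpl falling.
    assert (H1 := INR_fact_neq_0 n).
    assert (H2 : INR (S n) <> 0) by (apply not_0_INR; lia).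
    field; split; assumption.
Qed.

Lemma binom_ode_unique x (y : nat -> R) : y O = 1 ->
  seq_add (theta y) (conv seq_X (theta y)) = conv seq_X (conv (seq_const x) y) ->
  y = binom_coef x.
Proof.
  intros H0 H.
  assert (rec : forall w, seq_add (theta w) (conv seq_X (theta w))
      = conv seq_X (conv (seq_const x) w) ->
      forall n, INR (S n) * w (S n) = (x - INR n) * w n).
  { intros w Hw n; apply (f_equal (fun f => f (S n))) in Hw.
    unfold seq_add in Hw; rewrite !conv_X_S, conv_const_l in Hw.
    unfold theta in Hw; lra. }
  apply functional_extensionality; intros n; induction n as [|n IH].
  - rewrite H0; unfold binom_coef; simpl; field.
  - apply Rmult_eq_reg_l with (INR (S n)); [|apply not_0_INR; lia].
    now rewrite (rec _ H), (rec _ (binom_ode x)), IH.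
Qed.

(** The product of (1 + t)^x and (1 + t)^y has constant term 1 and, by the Leibniz rule, solves the
    equation of (1 + t)^(x + y), whose solution is unique. *)
Lemma binom_vandermonde x y : conv (binom_coef x) (binom_coef y) = binom_coef (x + y).
Proof.
  apply binom_ode_unique.
  - unfold binom_coef; simpl; field.
  - replace (seq_const (x + y)) with (seq_add (seq_const x) (seq_const y))
      by (apply functional_extensionality; intros [|n]; unfold seq_add; simpl; ring).
    rewrite theta_conv.
    set (f := binom_coef x); set (g := binom_coef y).
    transitivity (seq_add (conv (seq_add (theta f) (conv seq_X (theta f))) g)
                          (conv f (seq_add (theta g) (conv seq_X (theta g))))).
    + ring.
    + unfold f, g; rewrite !binom_ode; ring.
Qed.

Lemma poch_add a m n : poch a (m + n) = poch a m * poch (a + INR m) n.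
Proof.
  induction n as [|n IH].
  - rewrite Nat.add_0_r; simpl; ring.
  - rewrite Nat.add_succ_r; simpl; rewrite IH, plus_INR; ring.
Qed.

Lemma poch_S_l a n : poch a (S n) = a * poch (a + 1) n.
Proof. change (S n) with (1 + n)%nat; rewrite poch_add; simpl; ring. Qed.

Lemma falling_poch x k : falling (x + INR k) k = poch (x + 1) k.
Proof.
  revert x; induction k as [|k IH]; intros x.
  - reflexivity.
  - rewrite poch_S_l, <- IH; cbn [falling].
    replace (x + INR (S k)) with (x + 1 + INR k) by (rewrite S_INR; ring).
    ring.
Qed.

(** Brings the reciprocal to the denominator (al + 1)_n, which does not depend on k; the
    complementary factors (al + k + 1) ... (al + n) are a falling factorial from al + n. *)
Lemma inv_poch_falling al n k : (k <= n)%nat -> non_negint al ->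
  / poch (al + 1) k = falling (al + INR n) (n - k) / poch (al + 1) n.
Proof.
  intros Hk H.
  replace (al + INR n) with (al + INR k + INR (n - k))
    by (rewrite minus_INR by assumption; ring).
  rewrite falling_poch.
  replace (poch (al + 1) n) with (poch (al + 1) k * poch (al + INR k + 1) (n - k)).
  - field; split; apply poch_neq_0; intros j _; [|apply H].
    specialize (H (k + j)%nat); rewrite plus_INR in H; lra.
  - replace (al + INR k + 1) with (al + 1 + INR k) by ring.
    rewrite <- poch_add; f_equal; lia.
Qed.

(** Over the common denominator (al + 1)_n (be + 1)_n the summands are products of generalized
    binomial coefficients with upper entries be + n and al + n, so the sum is the one with upper
    entry al + be + 2n. *)
Lemma conv_bessel_coef al be n : non_negint al -> non_negint be ->
  conv (bessel_coef al) (bessel_coef be) n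
  = poch (al + be + INR n + 1) n
    / (INR (fact n) * poch (al + 1) n * poch (be + 1) n).
Proof.
  intros Ha Hb.
  assert (Pa : poch (al + 1) n <> 0) by (apply poch_neq_0; auto).
  assert (Pb : poch (be + 1) n <> 0) by (apply poch_neq_0; auto).
  rewrite conv_PS_mult; unfold PS_mult.
  transitivity (sum_f_R0 (fun k => (binom_coef (be + INR n) k
      * binom_coef (al + INR n) (n - k)) * / (poch (al + 1) n * poch (be + 1) n)) n).
  - apply sum_eq; intros k Hk; unfold bessel_coef, binom_coef.
    rewrite !Rinv_mult, (inv_poch_falling al n k), (inv_poch_falling be n (n - k))
      by (auto; lia).
    replace (n - (n - k))%nat with k by lia.
    unfold Rdiv; ring.
  - rewrite <- scal_sum.
    change (sum_f_R0 _ n) with (PS_mult (binom_coef (be + INR n)) (binom_coef (al + INR n)) n).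
    rewrite <- conv_PS_mult, binom_vandermonde; unfold binom_coef.
    replace (be + INR n + (al + INR n)) with (al + be + INR n + INR n) by ring.
    rewrite falling_poch. assert (H := INR_fact_neq_0 n). field; auto.
Qed.

(** * Coefficients of the 3F4 and the 2F3 *)

Lemma poch_duplication y m :
  poch (2 * y) (2 * m) = 4 ^ m * poch y m * poch (y + 1 / 2) m.
Proof.
  induction m as [|m IH]; [simpl; ring|].
  replace (2 * S m)%nat with (S (S (2 * m))) by lia.
  cbn [poch pow]; rewrite IH, S_INR, mult_INR; simpl (INR 2); field.
Qed.

Lemma poch_one n : poch 1 n = INR (fact n).
Proof.
  induction n as [|n IH]; [reflexivity|].
  change (fact (S n)) with (S n * fact n)%nat.
  rewrite mult_INR, S_INR; simpl; rewrite IH; ring.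
Qed.

Lemma poch_two n : poch 2 n = INR (fact (S n)).
Proof.
  rewrite <- poch_one, poch_S_l. replace (1 + 1) with 2 by ring; ring.
Qed.

(* Coefficients in t = (z/2)^2 of the term z^2 / (4 (1 - nu^2)) 3F4(z^2), with its prefactor. *)
Definition F34_coef (nu : R) (n : nat) : R :=
  match n with
  | O => 0
  | S m => / (1 - nu ^ 2) * (4 ^ m * (poch_prod [1; 1; 3 / 2] m
      / poch_prod [2; 2; 2 - nu; 2 + nu] m / INR (fact m)))
  end.

(** Coefficients in t of the 2F3 at z^2 = 4 t, which explains the powers of 4. *)
Definition F23_coef (nu : R) (m : nat) : R :=
  4 ^ m * (poch_prod [nu; 1 / 2 + nu] m
    / poch_prod [1 + nu; 1 + nu; 1 + 2 * nu] m / INR (fact m)).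

Lemma poch_shift_neq_0 al n : non_negint al -> poch (al + 2) n <> 0.
Proof.
  intros H; apply poch_neq_0; intros j _; specialize (H (S j)).
  rewrite S_INR in H; lra.
Qed.

(** At opposite orders the Vandermonde evaluation leaves (n + 1)_n / (n! (1 + nu)_n (1 - nu)_n).
    With n = m + 1, the first factors of the last two symbols produce the prefactor 1 / (1 - nu^2),
    and dividing by n produces the repeated parameters 1, 1 over 2, 2. *)
Lemma theta_F34_coef nu : non_negint nu -> non_negint (- nu) ->
  theta (F34_coef nu) = conv (seq_const (/ 2))
    (seq_sub (conv (bessel_coef nu) (bessel_coef (- nu))) (seq_const 1)).
Proof.
  intros Ha Hb; apply functional_extensionality; intros [|m];
    rewrite conv_const_l; unfold seq_sub.
  - unfold theta, bessel_coef; simpl; field.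
  - rewrite conv_bessel_coef by assumption.
    replace (nu + - nu + INR (S m) + 1) with (1 + INR (S m)) by ring.
    (* Completed by (1)_(m+1) the left side is (1)_(2m+2), which duplication splits into symbols at
       1/2 and 1; the leading factor 1/2 of the former leaves (3/2)_m. *)
    assert (D : poch (1 + INR (S m)) (S m) = 2 * 4 ^ m * poch (3 / 2) m).
    { apply Rmult_eq_reg_l with (poch 1 (S m)).
      - rewrite <- poch_add.
        replace (S m + S m)%nat with (2 * S m)%nat by lia.
        replace (poch 1 (2 * S m)) with (poch (2 * (1 / 2)) (2 * S m))
          by (f_equal; field).
        rewrite poch_duplication, (poch_S_l (1 / 2)).
        replace (1 / 2 + 1 / 2) with 1 by field.
        replace (1 / 2 + 1) with (3 / 2) by field.
        simpl pow; field.
      - rewrite poch_one; apply INR_fact_neq_0. }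
    rewrite D; unfold theta, F34_coef, poch_prod; cbn [fold_right seq_const].
    rewrite (poch_S_l (nu + 1)), (poch_S_l (- nu + 1)), poch_one, poch_two.
    replace (nu + 1 + 1) with (2 + nu) by ring.
    replace (- nu + 1 + 1) with (2 - nu) by ring.
    change (fact (S m)) with (S m * fact m)%nat; rewrite mult_INR.
    assert (H1 := INR_fact_neq_0 m).
    assert (H2 : INR (S m) <> 0) by (apply not_0_INR; lia).
    assert (H3 := poch_shift_neq_0 nu m Ha). rewrite Rplus_comm in H3.
    assert (H4 := poch_shift_neq_0 (- nu) m Hb).
    replace (- nu + 2) with (2 - nu) in H4 by ring.
    assert (H5 := Ha O); assert (H6 := Hb O); simpl in H5, H6.
    assert (H7 : 1 - nu ^ 2 <> 0).
    { replace (1 - nu ^ 2) with ((nu + 1 + 0) * (- nu + 1 + 0)) by ring.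
      now apply Rmult_integral_contrapositive. }
    field; repeat split; auto; lra.
Qed.

(** Here both orders are nu. Moving the last term to the left gives the operator theta + nu, which
    multiplies the m-th coefficient by nu + m. *)
Lemma theta_F23_coef nu : 0 < nu ->
  theta (F23_coef nu) = seq_sub (conv (seq_const nu)
      (conv (bessel_coef nu) (bessel_coef nu)))
    (conv (seq_const nu) (F23_coef nu)).
Proof.
  intros Hn.
  assert (Ha : non_negint nu) by (intros n; assert (H := pos_INR n); lra).
  apply functional_extensionality; intros m.
  unfold seq_sub; rewrite !conv_const_l, conv_bessel_coef by assumption.
  apply Rminus_diag_uniq; unfold theta.
  match goal with |- ?l = 0 => assert (E : l = (nu + INR m) * F23_coef nu m
     - nu * (poch (nu + nu + INR m + 1) m
       / (INR (fact m) * poch (nu + 1) m * poch (nu + 1) m))) by ring; rewrite E end.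
  replace (nu + nu + INR m + 1) with (1 + 2 * nu + INR m) by ring.
  assert (pos : forall x n, 0 < x -> poch x n <> 0).
  { intros x n Hx; apply poch_neq_0; intros j _; assert (H := pos_INR j); lra. }
  assert (D : poch (1 + 2 * nu + INR m) m
      = 4 ^ m * poch (nu + 1 / 2) m * poch (nu + 1) m / poch (1 + 2 * nu) m).
  { apply Rmult_eq_reg_l with (poch (1 + 2 * nu) m); [|apply pos; lra].
    rewrite <- poch_add. replace (m + m)%nat with (2 * m)%nat by lia.
    replace (1 + 2 * nu) with (2 * (nu + 1 / 2)) by field.
    rewrite poch_duplication. replace (nu + 1 / 2 + 1 / 2) with (nu + 1) by field.
    field; apply pos; lra. }
  (* The factor nu + m raises the upper parameter nu of the 2F3 to nu + 1, where it cancels one of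
     the lower parameters. *)
  assert (S1 : (nu + INR m) * poch nu m = nu * poch (nu + 1) m)
    by (rewrite <- poch_S_l; simpl; ring).
  rewrite D; unfold F23_coef, poch_prod; cbn [fold_right].
  rewrite (Rplus_comm 1 nu), (Rplus_comm (1 / 2) nu).
  transitivity ((4 ^ m * poch (nu + 1 / 2) m / (poch (nu + 1) m * poch (nu + 1) m
     * poch (1 + 2 * nu) m * INR (fact m)))
     * ((nu + INR m) * poch nu m - nu * poch (nu + 1) m)).
  - assert (H1 := INR_fact_neq_0 m).
    field; repeat split; auto; apply pos; lra.
  - rewrite S1; ring.
Qed.

(** * The inhomogeneous Bessel equation and its solution *)

Fixpoint harm (x : R) (k : nat) : R :=
  match k with O => 0 | S j => harm x j + / (x + INR j) end.

(** The sum has k + 1 terms, starting at 1/nu, because psi(nu + k + 1) = psi(nu) + [harm nu (S k)]: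
    what is split off is psi(nu), not psi(nu + 1). *)
Definition dbessel_coef (nu : R) (k : nat) : R := - (bessel_coef nu k * harm nu (S k)).

Definition bessel_op (nu : R) (y : nat -> R) : nat -> R :=
  seq_sub (seq_add (theta (theta y)) (conv (seq_const nu) (theta y))) (conv seq_X y).

(** By the recurrence of [bessel_coef] the harmonic sums of two neighbouring coefficients cancel up
    to one summand 1/(nu + k), and that removes the factor k + nu. *)
Lemma bessel_op_dbessel_coef nu : 0 < nu ->
  bessel_op nu (dbessel_coef nu) = seq_opp (theta (bessel_coef nu)).
Proof.
  intros Hn.
  assert (Ha : non_negint nu) by (intros n; assert (H := pos_INR n); lra).
  apply functional_extensionality; intros [|k];
    unfold bessel_op, seq_sub, seq_add, seq_opp; rewrite conv_const_l.
  - unfold theta; simpl; ring.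
  - rewrite conv_X_S; unfold theta, dbessel_coef.
    change (harm nu (S (S k))) with (harm nu (S k) + / (nu + INR (S k))).
    rewrite <- (bessel_coef_S nu k Ha).
    assert (H := pos_INR (S k)). field; lra.
Qed.

(** The coefficient of index n + 1 of the operator is (n + 1)(n + 1 + nu) y_(n+1) - y_n, so each
    coefficient is determined by the one before. *)
Lemma bessel_op_unique nu y1 y2 : 0 < nu -> y1 O = y2 O ->
  bessel_op nu y1 = bessel_op nu y2 -> y1 = y2.
Proof.
  intros Hn H0 H.
  apply functional_extensionality; intros n; induction n as [|n IH]; [exact H0|].
  apply (f_equal (fun f => f (S n))) in H.
  unfold bessel_op, seq_sub, seq_add in H.
  rewrite !conv_const_l, !conv_X_S, IH in H; unfold theta in H.
  assert (H1 := pos_INR n). rewrite S_INR in H.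
  apply Rmult_eq_reg_l with ((INR n + 1) * (INR n + 1 + nu)); [lra|].
  apply Rmult_integral_contrapositive; lra.
Qed.

Lemma dbessel_coef_eq nu : 0 < nu -> non_negint (- nu) ->
  dbessel_coef nu = seq_sub
    (conv (bessel_coef nu) (seq_sub (F34_coef nu) (seq_const (/ (2 * nu)))))
    (conv (seq_const (/ (2 * nu))) (conv (bessel_coef (- nu)) (F23_coef nu))).
Proof.
  intros Hn Hb.
  assert (Ha : non_negint nu) by (intros n; assert (H := pos_INR n); lra).
  apply (bessel_op_unique nu); [assumption| |rewrite bessel_op_dbessel_coef by assumption].
  (* Both constant terms are -1/nu: on the right each of the two occurrences of 1/(2 nu) contributes
     one half. *)
  - unfold dbessel_coef, seq_sub, bessel_coef, F23_coef, poch_prod; simpl; field; lra.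
  - assert (Ea := bessel_ode nu Ha); assert (Eb := bessel_ode (- nu) Hb).
    assert (W := bessel_wronskian nu Ha Hb); cbv zeta in W.
    assert (Tc := theta_F34_coef nu Ha Hb); assert (Td := theta_F23_coef nu Hn).
    assert (NK : conv (seq_const nu) (seq_const (/ (2 * nu))) = seq_const (/ 2)).
    { apply functional_extensionality; intros n; rewrite conv_const_l.
      destruct n; simpl; field; lra. }
    assert (HH : seq_add (seq_const (/ 2)) (seq_const (/ 2)) = seq_const 1)
      by (apply functional_extensionality; intros [|n]; unfold seq_add; simpl; field).
    replace (seq_const (- nu)) with (seq_opp (seq_const nu)) in Eb
      by (apply functional_extensionality; intros [|n]; unfold seq_opp; simpl; ring).
    assert (TN := theta_const nu); assert (Th := theta_const (/ 2));
    assert (TK := theta_const (/ (2 * nu))); assert (T1 := theta_const 1).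
    set (a := bessel_coef nu) in *; set (b := bessel_coef (- nu)) in *.
    set (c := F34_coef nu) in *; set (d := F23_coef nu) in *.
    set (N := seq_const nu) in *; set (K := seq_const (/ (2 * nu))) in *.
    set (h := seq_const (/ 2)) in *.
    assert (Ea' : theta (theta a) = seq_sub (conv seq_X a) (conv N (theta a)))
      by (rewrite <- Ea; ring).
    assert (Eb' : theta (theta b) = seq_add (conv seq_X b) (conv N (theta b)))
      by (rewrite <- Eb; ring).
    unfold bessel_op; fold N.
    repeat (rewrite ?theta_add, ?theta_sub, ?theta_conv, ?Tc, ?Td, ?TK, ?TN, ?Th, ?T1,
      ?Ea', ?Eb').
    rewrite ?TK, ?theta_const.
    (* Once second derivatives, [theta c] and [theta d] are eliminated, the right side is a/2 times
       (Wronskian - nu), minus [theta a]; the bracket is zero by [W]. Only nu / (2 nu) = 1/2 must be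
       supplied to [ring]. *)
    match goal with |- _ = ?r => transitivity (seq_sub (conv (conv h a) (seq_sub
      (seq_add (seq_sub (conv b (theta a)) (conv a (theta b))) (conv N (conv a b))) N))
      (conv (seq_add h h) (theta a))) end.
    + rewrite W, HH; ring.
    + ring [NK].
Qed.

(** * Euler's integral *)

Notation is_RInt_pos f l := (is_RInt_gen f (at_right 0) (Rbar_locally p_infty) l).

Lemma eventually_interval (P : R * R -> Prop) (a0 b0 : R) : 0 < a0 ->
  (forall a b, 0 < a < a0 -> b0 < b -> P (a, b)) ->
  filter_prod (at_right 0) (Rbar_locally p_infty) P.
Proof.
  intros Ha HP.
  apply (Filter_prod _ _ _ (fun a => 0 < a < a0) (fun b => b0 < b)).
  - exists (mkposreal a0 Ha); intros y Hy Hy0; split; [exact Hy0|].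
    unfold ball in Hy; simpl in Hy; unfold AbsRing_ball, abs, minus, plus, opp in Hy;
    simpl in Hy. apply Rabs_def2 in Hy; lra.
  - now exists b0.
  - intros a b H1 H2; now apply HP.
Qed.

Lemma is_RInt_pos_nonneg (f : R -> R) (l : R) : (forall t, 0 < t -> 0 <= f t) ->
  is_RInt_pos f l -> 0 <= l.
Proof.
  intros Hf Hl.
  apply Rle_trans with (norm l); [apply norm_ge_0|].
  apply (RInt_gen_norm (Fa := at_right 0) (Fb := Rbar_locally p_infty) f f l l);
    try exact Hl.
  - apply (eventually_interval _ 1 1); [lra|simpl; intros; lra].
  - apply (eventually_interval _ 1 1); [lra|simpl; intros a b Ha Hb t Ht].
    unfold norm; simpl; unfold abs; simpl. rewrite Rabs_pos_eq; [lra|apply Hf; lra].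
Qed.

(** For a nonnegative integrand the integral grows with the interval, so the improper integral is
    the supremum over compact subintervals. *)
Lemma ex_RInt_pos_bounded (f : R -> R) (M : R) : (forall t, 0 < t -> 0 <= f t) ->
  (forall t, 0 < t -> continuous f t) ->
  (forall a b, 0 < a < b -> RInt f a b <= M) ->
  exists l, is_RInt_pos f l.
Proof.
  intros Hf Hc HM.
  assert (Hex : forall a b, 0 < a -> 0 < b -> ex_RInt f a b).
  { intros a b Ha Hb; apply (ex_RInt_continuous (V := R_CompleteNormedModule)); intros z [Hz _]; apply Hc.
    apply Rlt_le_trans with (2 := Hz); now apply Rmin_pos. }
  set (E := fun r => exists a b, 0 < a < b /\ r = RInt f a b).
  destruct (completeness E) as [l [Hub Hlub]].
  - exists M; intros r (a & b & Hab & ->); now apply HM.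
  - exists (RInt f 1 2), 1, 2; split; [lra|reflexivity].
  - exists l; intros P [eps HP].
    assert (exists a0 b0, 0 < a0 < b0 /\ l - eps < RInt f a0 b0) as (a0 & b0 & H0 & H1).
    { destruct (Classical_Prop.classic
        (exists a0 b0, 0 < a0 < b0 /\ l - eps < RInt f a0 b0)) as [H|H]; [exact H|].
      assert (l <= l - eps); [|generalize (cond_pos eps); lra].
      apply Hlub; intros r (a & b & Hab & ->).
      apply Rnot_lt_le; intros Hr; apply H; now exists a, b. }
    apply (eventually_interval _ a0 b0); [lra|intros a b Ha Hb; exists (RInt f a b)].
    split; [apply (RInt_correct (V := R_CompleteNormedModule)), Hex; lra|].
    apply HP; unfold ball; simpl; unfold AbsRing_ball, abs, minus, plus, opp; simpl.
    assert (RInt f a b <= l) by (apply Hub; exists a, b; split; [lra|reflexivity]).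
    assert (RInt f a0 b0 <= RInt f a b).
    { rewrite <- (RInt_Chasles f a a0 b) by (apply Hex; lra).
      rewrite <- (RInt_Chasles f a0 b0 b) by (apply Hex; lra).
      unfold plus; simpl.
      assert (0 <= RInt f a a0)
        by (apply RInt_ge_0; [lra|apply Hex; lra|intros; apply Hf; lra]).
      assert (0 <= RInt f b0 b)
        by (apply RInt_ge_0; [lra|apply Hex; lra|intros; apply Hf; lra]).
      lra. }
    apply Rabs_def1; lra.
Qed.

Lemma ln_le_sub_1 u : 0 < u -> ln u <= u - 1.
Proof.
  intros Hu; assert (H := exp_ineq1_le (ln u)); rewrite exp_ln in H; lra.
Qed.

(** t^p exp(-t) is largest at t = p; the tangent bound of ln at t/p gives this up to a dropped
    factor exp(-p). *)
Lemma Rpower_le_exp p t : 0 < p -> 0 < t -> Rpower t p <= Rpower p p * exp t.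
Proof.
  intros Hp Ht; unfold Rpower; rewrite <- exp_plus.
  assert (H : ln (t / p) <= t / p - 1)
    by (apply ln_le_sub_1; now apply Rdiv_lt_0_compat).
  rewrite ln_div in H by assumption.
  apply (Rmult_le_compat_l p) in H; [|lra].
  replace (p * (t / p - 1)) with (t - p) in H by (field; lra).
  destruct (Rle_lt_or_eq_dec (p * ln t) (p * ln p + t)) as [H1|H1]; [lra| |].
  - left; now apply exp_increasing.
  - right; now f_equal.
Qed.

Lemma Rpower_pos x y : 0 < Rpower x y.
Proof. apply exp_pos. Qed.

Lemma Rpower_pred t x : 0 < t -> Rpower t (x - 1) = Rpower t x / t.
Proof.
  intros Ht; unfold Rminus, Rdiv.
  now rewrite Rpower_plus, Rpower_Ropp, Rpower_1.
Qed.

Definition gamma_integrand (x t : R) : R := Rpower t (x - 1) * exp (- t).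

Lemma gamma_integrand_pos x t : 0 < gamma_integrand x t.
Proof. apply Rmult_lt_0_compat; [apply Rpower_pos|apply exp_pos]. Qed.

Lemma gamma_integrand_continuous x t : 0 < t -> continuous (gamma_integrand x) t.
Proof.
  intros Ht; apply (ex_derive_continuous (V := R_NormedModule)).
  unfold gamma_integrand, Rpower; auto_derive; lra.
Qed.

(* The integrand is dominated by a multiple of the derivative of the bounded function
   [1 - 1 / (1 + t^x)]. *)
Lemma ex_gamma_integral x : 0 < x -> exists l, is_RInt_pos (gamma_integrand x) l.
Proof.
  (* Chosen so that (1 + t^x)^2 <= 2 (1 + t^(2x)) <= K exp(t), the second step by [Rpower_le_exp]
     with exponent 2x. *)
  intros Hx; set (K := 2 * (1 + Rpower (2 * x) (2 * x))).
  assert (HK : 0 < K) by (unfold K; assert (H := Rpower_pos (2 * x) (2 * x)); lra).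
  set (dh := fun t => K / x * (x * Rpower t x / t / (1 + Rpower t x) ^ 2)).
  assert (D : forall t, 0 < t -> is_derive (fun t => K / x * (1 - / (1 + Rpower t x))) t (dh t)).
  { intros t Ht; unfold dh, Rpower; assert (H := exp_pos (x * ln t)).
    auto_derive; [repeat split; lra|]. field; repeat split; lra. }
  assert (C : forall t, 0 < t -> continuous dh t).
  { intros t Ht; apply (ex_derive_continuous (V := R_NormedModule)).
    unfold dh, Rpower; assert (H := exp_pos (x * ln t)); auto_derive.
    repeat split; try lra.
    apply Rgt_not_eq; repeat apply Rmult_lt_0_compat; lra. }
  apply ex_RInt_pos_bounded with (M := K / x).
  - intros t _; apply Rlt_le, gamma_integrand_pos.
  - intros t Ht; now apply gamma_integrand_continuous.
  - intros a b Hab.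
    assert (I : is_RInt dh a b
        (minus (K / x * (1 - / (1 + Rpower b x))) (K / x * (1 - / (1 + Rpower a x))))).
    { apply (is_RInt_derive (V := R_CompleteNormedModule)
        (fun t => K / x * (1 - / (1 + Rpower t x)))); rewrite Rmin_left by lra;
      intros t Ht; [apply D|apply C]; lra. }
    apply Rle_trans with (RInt dh a b).
    + apply RInt_le; [lra| |eexists; exact I|].
      * apply (ex_RInt_continuous (V := R_CompleteNormedModule));
          rewrite Rmin_left by lra; intros t Ht; apply gamma_integrand_continuous; lra.
      * intros t Ht; unfold gamma_integrand, dh.
        rewrite Rpower_pred by lra.
        assert (P := Rpower_pos t x).
        replace (K / x * (x * Rpower t x / t / (1 + Rpower t x) ^ 2))
          with (Rpower t x / t * (K / (1 + Rpower t x) ^ 2)) by (field; repeat split; lra).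
        apply Rmult_le_compat_l; [apply Rlt_le, Rdiv_lt_0_compat; lra|].
        rewrite exp_Ropp. assert (Pe := exp_pos t).
        apply Rmult_le_reg_l with (exp t * (1 + Rpower t x) ^ 2).
        { apply Rmult_lt_0_compat; [lra|apply pow_lt; lra]. }
        replace (exp t * (1 + Rpower t x) ^ 2 * / exp t)
          with ((1 + Rpower t x) ^ 2) by (field; lra).
        replace (exp t * (1 + Rpower t x) ^ 2 * (K / (1 + Rpower t x) ^ 2))
          with (K * exp t) by (field; lra).
        assert (H2 := Rpower_le_exp (2 * x) t ltac:(lra) ltac:(lra)).
        replace (2 * x) with (x + x) in H2 at 1 by ring.
        rewrite Rpower_plus in H2.
        assert (1 < exp t) by (rewrite <- exp_0; apply exp_increasing; lra).
        unfold K. assert (0 <= (1 - Rpower t x) ^ 2) by apply pow2_ge_0. nra.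
    + rewrite (is_RInt_unique _ _ _ _ I); unfold minus, plus, opp; simpl.
      assert (Pa := Rpower_pos a x); assert (Pb := Rpower_pos b x).
      assert (0 < / (1 + Rpower b x)) by (apply Rinv_0_lt_compat; lra).
      assert (/ (1 + Rpower a x) <= 1)
        by (rewrite <- Rinv_1; apply Rinv_le_contravar; lra).
      assert (0 < K / x) by (apply Rdiv_lt_0_compat; lra). nra.
Qed.

Lemma is_gamma_integral x : 0 < x -> is_RInt_pos (gamma_integrand x) (Gamma_int x).
Proof.
  intros Hx.
  change (is_RInt_pos (gamma_integrand x)
    (RInt_gen (gamma_integrand x) (at_right 0) (Rbar_locally p_infty))).
  apply (RInt_gen_correct (V := R_CompleteNormedModule) (Fa := at_right 0)
    (Fb := Rbar_locally p_infty) (gamma_integrand x)).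
  exact (ex_gamma_integral x Hx).
Qed.

Lemma Gamma_int_unique x l : is_RInt_pos (gamma_integrand x) l -> Gamma_int x = l.
Proof.
  intros H.
  exact (is_RInt_gen_unique (V := R_CompleteNormedModule) (Fa := at_right 0)
    (Fb := Rbar_locally p_infty) (gamma_integrand x) l H).
Qed.

Lemma Gamma_int_nonneg x : 0 < x -> 0 <= Gamma_int x.
Proof.
  intros Hx; apply is_RInt_pos_nonneg with (gamma_integrand x).
  - intros t _; apply Rlt_le, gamma_integrand_pos.
  - now apply is_gamma_integral.
Qed.

Lemma filterlim_Rpower_exp_0 x : 0 < x ->
  filterlim (fun t => Rpower t x * exp (- t)) (at_right 0) (locally 0).
Proof.
  intros Hx P [eps HP].
  (* For t < eps^(1/x) the power t^x is already below eps, and exp(-t) <= 1. *)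
  exists (mkposreal _ (Rpower_pos eps (/ x))); intros t Ht Ht0; apply HP.
  unfold ball in *; simpl in *; unfold AbsRing_ball, abs, minus, plus, opp in *; simpl in *.
  rewrite Ropp_0, Rplus_0_r in *. rewrite Rabs_pos_eq in Ht by lra.
  assert (H := gamma_integrand_pos (x + 1) t); unfold gamma_integrand in H.
  replace (x + 1 - 1) with x in H by ring.
  rewrite Rabs_pos_eq by lra.
  apply Rle_lt_trans with (Rpower t x * 1).
  - apply Rmult_le_compat_l; [apply Rlt_le, Rpower_pos|].
    left; rewrite <- exp_0; apply exp_increasing; lra.
  - rewrite Rmult_1_r. apply Rlt_le_trans with (Rpower (Rpower eps (/ x)) x).
    + apply Rlt_Rpower_l; lra.
    + rewrite Rpower_mult, Rinv_l, Rpower_1 by (try lra; apply cond_pos); lra.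
Qed.

Lemma filterlim_Rpower_exp_infty x : 0 <= x ->
  filterlim (fun t => Rpower t x * exp (- t)) (Rbar_locally p_infty) (locally 0).
Proof.
  intros Hx P [eps HP]. set (C := Rpower (x + 1) (x + 1)).
  assert (HC : 0 < C) by apply Rpower_pos. assert (He := cond_pos eps).
  (* Since t^(x+1) <= C exp(t), the function is at most C / t. *)
  exists (C / eps); intros t Ht; apply HP.
  assert (Ht0 : 0 < t) by (apply Rlt_trans with (2 := Ht), Rdiv_lt_0_compat; lra).
  unfold ball; simpl; unfold AbsRing_ball, abs, minus, plus, opp; simpl.
  rewrite Ropp_0, Rplus_0_r.
  assert (H := gamma_integrand_pos (x + 1) t); unfold gamma_integrand in H.
  replace (x + 1 - 1) with x in H by ring.
  rewrite Rabs_pos_eq by lra.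
  assert (H1 := Rpower_le_exp (x + 1) t ltac:(lra) Ht0).
  rewrite Rpower_plus, Rpower_1 in H1 by assumption; fold C in H1.
  rewrite exp_Ropp. assert (Pe := exp_pos t).
  apply Rle_lt_trans with (C / t).
  - apply Rmult_le_reg_l with (t * exp t); [now apply Rmult_lt_0_compat|].
    replace (t * exp t * (Rpower t x * / exp t)) with (Rpower t x * t) by (field; lra).
    replace (t * exp t * (C / t)) with (C * exp t) by (field; lra). exact H1.
  - apply Rmult_lt_reg_l with (t / eps); [now apply Rdiv_lt_0_compat|].
    replace (t / eps * (C / t)) with (C / eps) by (field; lra).
    replace (t / eps * eps) with t by (field; lra). exact Ht.
Qed.

Lemma Derive_power_exp x t : 0 < t ->
  is_derive (fun t => Rpower t x * exp (- t)) t
    (x * gamma_integrand x t - gamma_integrand (x + 1) t).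
Proof.
  intros Ht; unfold gamma_integrand.
  replace (x + 1 - 1) with x by ring. rewrite Rpower_pred by assumption.
  unfold Rpower; auto_derive; [assumption|]. field; lra.
Qed.

Lemma is_RInt_pos_derive (f df : R -> R) (l0 l1 : R) :
  (forall t, 0 < t -> is_derive f t (df t)) -> (forall t, 0 < t -> continuous df t) ->
  filterlim f (at_right 0) (locally l0) -> filterlim f (Rbar_locally p_infty) (locally l1) ->
  is_RInt_pos df (l1 - l0).
Proof.
  intros Hd Hc H0 H1.
  assert (HD : forall t, 0 < t -> df t = Derive f t)
    by (intros t Ht; symmetry; now apply is_derive_unique, Hd).
  apply (is_RInt_gen_ext (Derive f)).
  - apply (eventually_interval _ 1 1); [lra|simpl; intros a b Ha Hb t].
    rewrite Rmin_left by lra; intros Ht; symmetry; apply HD; lra.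
  - apply is_RInt_gen_Derive; try assumption.
    + apply (eventually_interval _ 1 1); [lra|simpl; intros a b Ha Hb t].
      rewrite Rmin_left by lra; intros Ht; eexists; apply Hd; lra.
    + apply (eventually_interval _ 1 1); [lra|simpl; intros a b Ha Hb t].
      rewrite Rmin_left by lra; intros Ht.
      apply (continuous_ext_loc (T := R_UniformSpace) (U := R_UniformSpace) (Derive f) df t);
        [|apply Hc; lra].
      assert (Ht0 : 0 < t) by lra.
      exists (mkposreal t Ht0); intros y Hy; apply HD.
      unfold ball in Hy; simpl in Hy; unfold AbsRing_ball, abs, minus, plus, opp in Hy;
      simpl in Hy. apply Rabs_def2 in Hy; lra.
Qed.

(** Integration by parts: the derivative of t^x exp(-t) has integral 0, since its primitive vanishes
    at both ends. *)
Lemma Gamma_int_S x : 0 < x -> Gamma_int (x + 1) = x * Gamma_int x.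
Proof.
  intros Hx; apply Gamma_int_unique.
  assert (I : is_RInt_pos (fun t => x * gamma_integrand x t - gamma_integrand (x + 1) t) (0 - 0)).
  { apply is_RInt_pos_derive with (f := fun t => Rpower t x * exp (- t)).
    - intros t Ht; now apply Derive_power_exp.
    - intros t Ht.
      apply (continuous_minus (V := R_NormedModule)
        (fun t => x * gamma_integrand x t) (gamma_integrand (x + 1))).
      + apply (continuous_scal_r (V := R_NormedModule) x).
        now apply gamma_integrand_continuous.
      + now apply gamma_integrand_continuous.
    - now apply filterlim_Rpower_exp_0.
    - apply filterlim_Rpower_exp_infty; lra. }
  apply (is_RInt_gen_ext (fun t => minus (scal x (gamma_integrand x t))
    (x * gamma_integrand x t - gamma_integrand (x + 1) t))).
  - apply (eventually_interval _ 1 1); [lra|intros a b _ _ t _].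
    unfold minus, plus, opp, scal; simpl; unfold mult; simpl; ring.
  - replace (x * Gamma_int x) with (minus (scal x (Gamma_int x)) (0 - 0))
      by (unfold minus, plus, opp, scal; simpl; unfold mult; simpl; ring).
    apply (is_RInt_gen_minus (V := R_NormedModule)); [|exact I].
    apply (is_RInt_gen_scal (V := R_NormedModule)); now apply is_gamma_integral.
Qed.

Lemma Gamma_int_1 : Gamma_int 1 = 1.
Proof.
  apply Gamma_int_unique. replace 1 with (0 - - (1)) at 2 by ring.
  apply is_RInt_pos_derive with (f := fun t => - exp (- t)).
  - intros t Ht; unfold gamma_integrand. rewrite Rminus_diag_eq, Rpower_O by auto.
    auto_derive; [easy|ring].
  - intros t Ht; now apply gamma_integrand_continuous.
  - apply (filterlim_filter_le_1 (F := locally 0)).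
    + apply filter_le_within.
    + replace (- (1)) with (- exp (- 0)) by (rewrite Ropp_0, exp_0; ring).
      apply (ex_derive_continuous (V := R_NormedModule) (fun t => - exp (- t)) 0).
      now auto_derive.
  - replace 0 with (opp 0) by (unfold opp; simpl; ring).
    apply (filterlim_comp _ _ _ (fun t => exp (- t)) opp _ (locally 0));
      [|apply (filterlim_opp (V := R_NormedModule) 0)].
    apply filterlim_ext_loc with (2 := filterlim_Rpower_exp_infty 0 (Rle_refl 0)).
    exists 0; intros t Ht; rewrite Rpower_O by assumption; ring.
Qed.

Lemma Gamma_int_nat n : Gamma_int (INR n + 1) = INR (fact n).
Proof.
  induction n as [|n IH].
  - simpl; rewrite Rplus_0_l; apply Gamma_int_1.
  - assert (H := pos_INR n). rewrite S_INR, Gamma_int_S, IH by lra.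
    change (fact (S n)) with (S n * fact n)%nat. rewrite mult_INR, S_INR; ring.
Qed.

(* Weighted AM-GM on the integrand, [t^s <= x^s (1 + s (t/x - 1))], makes the two
   occurrences of Gamma x cancel (Wendel's inequality). *)
Lemma Gamma_int_wendel x s : 0 < x -> 0 <= s <= 1 ->
  Gamma_int (x + s) <= Rpower x s * Gamma_int x.
Proof.
  intros Hx Hs.
  (* The bound x^s (1 + s (t/x - 1)) is the affine function k1 t + k2, so its integral against the
     weight is k1 Gamma(x + 1) + k2 Gamma(x). *)
  set (k1 := Rpower x s * (s / x)); set (k2 := Rpower x s * (1 - s)).
  assert (I : is_RInt_pos (fun t => minus (plus (scal k1 (gamma_integrand (x + 1) t))
     (scal k2 (gamma_integrand x t))) (gamma_integrand (x + s) t))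
     (minus (plus (scal k1 (Gamma_int (x + 1))) (scal k2 (Gamma_int x))) (Gamma_int (x + s)))).
  { apply (is_RInt_gen_minus (V := R_NormedModule));
      [apply (is_RInt_gen_plus (V := R_NormedModule));
         apply (is_RInt_gen_scal (V := R_NormedModule))|];
      apply is_gamma_integral; lra. }
  apply is_RInt_pos_nonneg in I.
  - rewrite Gamma_int_S in I by assumption.
    unfold minus, plus, opp, scal in I; simpl in I; unfold mult in I; simpl in I.
    replace (k1 * (x * Gamma_int x) + k2 * Gamma_int x)
      with (Rpower x s * Gamma_int x) in I by (unfold k1, k2; field; lra).
    lra.
  - intros t Ht; unfold minus, plus, opp, scal; simpl; unfold mult; simpl.
    unfold gamma_integrand.
    replace (x + 1 - 1) with (x - 1 + 1) by ring.
    replace (x + s - 1) with (x - 1 + s) by ring.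
    rewrite !Rpower_plus, Rpower_1 by assumption.
    assert (P1 := Rpower_pos t (x - 1)); assert (P2 := exp_pos (- t)).
    assert (P3 := Rpower_pos x s).
    assert (AG : Rpower t s <= Rpower x s * (1 + s * (t / x - 1))).
    { replace (Rpower t s) with (Rpower x s * Rpower (t / x) s).
      - apply Rmult_le_compat_l; [lra|].
        assert (Hu : 0 < t / x) by (now apply Rdiv_lt_0_compat).
        set (u := t / x) in *.
        destruct (Req_dec s 0) as [->|Hs0]; [rewrite Rpower_O; lra|].
        destruct (Req_dec s 1) as [->|Hs1]; [rewrite Rpower_1; lra|].
        assert (Hv : 0 < 1 + s * (u - 1)) by nra.
        rewrite <- (exp_ln (1 + s * (u - 1))) by assumption. unfold Rpower.
        (* With v = s u + (1 - s), the bounds for ln(u/v) and ln(1/v), weighted by s and 1 - s, add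
           up to s ln u <= ln v. *)
        assert (L1 := ln_le_sub_1 (u / (1 + s * (u - 1))) ltac:(now apply Rdiv_lt_0_compat)).
        assert (L2 := ln_le_sub_1 (1 / (1 + s * (u - 1))) ltac:(apply Rdiv_lt_0_compat; lra)).
        rewrite ln_div in L1, L2 by lra. rewrite ln_1 in L2.
        assert (E : s * (u / (1 + s * (u - 1))) + (1 - s) * (1 / (1 + s * (u - 1))) = 1)
          by (field; lra).
        assert (s * ln u <= ln (1 + s * (u - 1))) by nra.
        destruct (Rle_lt_or_eq_dec _ _ H) as [H'|H'];
          [left; now apply exp_increasing|right; now f_equal].
      - rewrite Rpower_mult_distr by (auto; now apply Rdiv_lt_0_compat).
        f_equal; field; lra. }
    unfold k1, k2.
    replace (Rpower x s * (s / x) * (Rpower t (x - 1) * t * exp (- t))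
       + Rpower x s * (1 - s) * (Rpower t (x - 1) * exp (- t))
       + - (Rpower t (x - 1) * Rpower t s * exp (- t)))
      with (Rpower t (x - 1) * exp (- t)
        * (Rpower x s * (1 + s * (t / x - 1)) - Rpower t s)) by (field; lra).
    apply Rmult_le_pos; [apply Rmult_le_pos; lra|lra].
Qed.

(** A zero at x would spread by Wendel's inequality to the next integer n + 1, where the value is
    n!. *)
Lemma Gamma_int_pos x : 0 < x -> 0 < Gamma_int x.
Proof.
  intros Hx; destruct (Gamma_int_nonneg x Hx) as [H|H]; [exact H|exfalso].
  destruct (nfloor_ex x (Rlt_le _ _ Hx)) as [n Hn].
  assert (W := Gamma_int_wendel x (INR n + 1 - x) Hx ltac:(lra)).
  replace (x + (INR n + 1 - x)) with (INR n + 1) in W by ring.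
  rewrite Gamma_int_nat, <- H, Rmult_0_r in W.
  assert (P := INR_fact_lt_0 n); lra.
Qed.

(** * Differentiability of Gamma and the reflection formula *)

Lemma locally_R_iff (x : R) (P : R -> Prop) :
  locally x P <-> exists d, 0 < d /\ forall y, Rabs (y - x) < d -> P y.
Proof.
  split.
  - intros [d H]; exists d; split; [apply cond_pos|exact H].
  - intros (d & Hd & H); exists (mkposreal d Hd); exact H.
Qed.

(* The increments of [F] are those of [phi n] up to an arbitrarily small multiple of
   [|y - x|]; unlike for uniform convergence of derivatives, no derivative is needed away
   from [x]. *)
Lemma is_derive_of_approx (F : R -> R) (phi : nat -> R -> R) (dphi eps : nat -> R) (x l : R) :
  (forall n, is_derive (phi n) x (dphi n)) -> is_lim_seq eps 0 ->
  (forall n, locally x (fun y =>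
     Rabs (F y - F x - (phi n y - phi n x)) <= eps n * Rabs (y - x))) ->
  is_lim_seq dphi l -> is_derive F x l.
Proof.
  intros Hphi Heps HF Hl; apply is_derive_Reals; intros e He.
  assert (He3 : 0 < e / 3) by lra.
  apply is_lim_seq_spec in Heps; apply is_lim_seq_spec in Hl.
  destruct (Heps (mkposreal _ He3)) as [N1 H1]; destruct (Hl (mkposreal _ He3)) as [N2 H2].
  set (n := Nat.max N1 N2).
  specialize (H1 n (Nat.le_max_l _ _)); specialize (H2 n (Nat.le_max_r _ _)).
  simpl in H1, H2; rewrite Rminus_0_r in H1.
  destruct (proj1 (locally_R_iff _ _) (HF n)) as (d1 & Hd1 & A1).
  assert (D := Hphi n); apply is_derive_Reals in D; destruct (D _ He3) as [d2 A2].
  assert (Hd : 0 < Rmin d1 d2) by (apply Rmin_pos; [exact Hd1|apply cond_pos]).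
  exists (mkposreal _ Hd); intros h Hh0 Hh; simpl in Hh.
  assert (B1 := Rmin_l d1 d2); assert (B2 := Rmin_r d1 d2).
  specialize (A1 (x + h)); replace (x + h - x) with h in A1 by ring.
  specialize (A1 ltac:(lra)); specialize (A2 h Hh0 ltac:(lra)).
  replace ((F (x + h) - F x) / h - l)
    with ((F (x + h) - F x - (phi n (x + h) - phi n x)) / h
      + ((phi n (x + h) - phi n x) / h - dphi n) + (dphi n - l)) by (field; exact Hh0).
  assert (A3 : Rabs ((F (x + h) - F x - (phi n (x + h) - phi n x)) / h) <= eps n).
  { unfold Rdiv; rewrite Rabs_mult, Rabs_inv.
    assert (0 < Rabs h) by (now apply Rabs_pos_lt).
    apply Rmult_le_reg_r with (Rabs h); [assumption|].
    rewrite Rmult_assoc, Rinv_l, Rmult_1_r by lra; exact A1. }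
  assert (T1 := Rabs_triang ((F (x + h) - F x - (phi n (x + h) - phi n x)) / h
      + ((phi n (x + h) - phi n x) / h - dphi n)) (dphi n - l)).
  assert (T2 := Rabs_triang ((F (x + h) - F x - (phi n (x + h) - phi n x)) / h)
      ((phi n (x + h) - phi n x) / h - dphi n)).
  assert (T3 := Rle_abs (eps n)). lra.
Qed.

Lemma is_derive_le_lipschitz (g : R -> R) (x l K : R) : is_derive g x l ->
  locally x (fun y => Rabs (g y - g x) <= K * Rabs (y - x)) -> Rabs l <= K.
Proof.
  intros D H; apply Rnot_lt_le; intros HK.
  apply is_derive_Reals in D; destruct (D (Rabs l - K)) as [d1 A1]; [lra|].
  apply locally_R_iff in H; destruct H as (d2 & Hd2 & A2).
  assert (Hd : 0 < Rmin d1 d2) by (apply Rmin_pos; [apply cond_pos|exact Hd2]).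
  assert (B1 := Rmin_l d1 d2); assert (B2 := Rmin_r d1 d2).
  set (h := Rmin d1 d2 / 2) in *.
  assert (Hh : 0 < h) by (unfold h; lra). assert (Hh1 : h < Rmin d1 d2) by (unfold h; lra).
  specialize (A1 h ltac:(lra)); specialize (A2 (x + h)).
  replace (x + h - x) with h in A2 by ring. rewrite (Rabs_pos_eq h) in A1, A2 by lra.
  specialize (A1 ltac:(lra)); specialize (A2 ltac:(lra)).
  assert (A3 : Rabs ((g (x + h) - g x) / h) <= K).
  { unfold Rdiv; rewrite Rabs_mult, Rabs_inv, (Rabs_pos_eq h) by lra.
    apply Rmult_le_reg_r with h; [assumption|].
    rewrite Rmult_assoc, Rinv_l, Rmult_1_r by lra; exact A2. }
  assert (T := Rabs_triang ((g (x + h) - g x) / h) (- ((g (x + h) - g x) / h - l))).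
  rewrite Rabs_Ropp in T.
  replace ((g (x + h) - g x) / h + - ((g (x + h) - g x) / h - l)) with l in T by ring. lra.
Qed.

(** Comparing two approximants through F shows that their difference has Lipschitz constant eps n +
    eps m at x. Hence the derivatives at x form a Cauchy sequence, and no candidate for the limit is
    required. *)
Lemma ex_derive_of_approx (F : R -> R) (phi : nat -> R -> R) (dphi eps : nat -> R) (x : R) :
  (forall n, is_derive (phi n) x (dphi n)) -> is_lim_seq eps 0 ->
  (forall n, locally x (fun y =>
     Rabs (F y - F x - (phi n y - phi n x)) <= eps n * Rabs (y - x))) ->
  ex_derive F x.
Proof.
  intros Hphi Heps HF.
  assert (ex_finite_lim_seq dphi) as [l Hl].
  { apply ex_lim_seq_cauchy_corr; intros e.
    apply is_lim_seq_spec in Heps.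
    assert (He : 0 < e / 2) by (assert (H := cond_pos e); lra).
    destruct (Heps (mkposreal _ He)) as [N HN]; exists N; intros n m Hn Hm.
    assert (B : Rabs (dphi n - dphi m) <= eps n + eps m).
    { apply is_derive_le_lipschitz with (g := fun y => phi n y - phi m y) (x := x).
      - apply (is_derive_minus (V := R_NormedModule)); apply Hphi.
      - apply filter_imp with (2 := filter_and _ _ (HF n) (HF m)); intros y [H1 H2].
        rewrite <- Rabs_Ropp in H1.
        assert (T := Rabs_triang (- (F y - F x - (phi n y - phi n x)))
          (F y - F x - (phi m y - phi m x))).
        replace (- (F y - F x - (phi n y - phi n x)) + (F y - F x - (phi m y - phi m x)))
          with (phi n y - phi m y - (phi n x - phi m x)) in T by ring.
        lra. }
    assert (H1 := HN n Hn); assert (H2 := HN m Hm); simpl in H1, H2.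
    rewrite Rminus_0_r in H1, H2.
    assert (T1 := Rle_abs (eps n)); assert (T2 := Rle_abs (eps m)); simpl in *; lra. }
  exists l; now apply (is_derive_of_approx F phi dphi eps x l).
Qed.

(** * Increments of ln Gamma and differentiability of Gamma *)

Lemma poch_pos x k : 0 < x -> 0 < poch x k.
Proof.
  intros Hx; induction k as [|k IH]; simpl; [lra|].
  assert (H := pos_INR k); apply Rmult_lt_0_compat; lra.
Qed.

Lemma is_derive_poch x k : 0 < x -> is_derive (fun y => poch y k) x (poch x k * harm x k).
Proof.
  intros Hx; induction k as [|k IH]; simpl.
  - rewrite Rmult_0_r; apply (is_derive_const (V := R_NormedModule)).
  - assert (H := pos_INR k).
    evar_last.
    + apply (is_derive_mult (fun y => poch y k) (fun y => y + INR k)); [exact IH| |apply Rmult_comm].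
      apply (is_derive_plus (V := R_NormedModule) (fun y => y));
        [apply is_derive_id|apply is_derive_const].
    + unfold plus, mult, one, zero; simpl; unfold mult; simpl; field; lra.
Qed.

Lemma Gamma_int_poch y n : 0 < y -> Gamma_int (y + INR n) = poch y n * Gamma_int y.
Proof.
  intros Hy; induction n as [|n IH].
  - simpl; rewrite Rplus_0_r; ring.
  - assert (H := pos_INR n). rewrite S_INR, <- Rplus_assoc, Gamma_int_S, IH by lra.
    simpl; ring.
Qed.

Lemma ln_add_le w h : 0 < w -> 0 <= h -> ln (w + h) - ln w <= h / w.
Proof.
  intros Hw Hh. rewrite <- ln_div by lra.
  apply Rle_trans with (1 := ln_le_sub_1 ((w + h) / w) ltac:(apply Rdiv_lt_0_compat; lra)).
  right; field; lra.
Qed.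

(** The upper bound is Wendel's inequality from w to w + h. The lower one is the same inequality
    from w + h to w + 1, where Gamma(w + 1) = w Gamma(w). *)
Lemma ln_Gamma_int_increment w h : 0 < w -> 0 <= h <= 1 ->
  h * ln w - h / w <= ln (Gamma_int (w + h)) - ln (Gamma_int w) <= h * ln w.
Proof.
  intros Hw Hh.
  assert (P1 := Gamma_int_pos w Hw); assert (P2 := Gamma_int_pos (w + h) ltac:(lra)).
  split.
  - assert (W := Gamma_int_wendel (w + h) (1 - h) ltac:(lra) ltac:(lra)).
    replace (w + h + (1 - h)) with (w + 1) in W by ring.
    rewrite Gamma_int_S in W by assumption.
    apply ln_le in W; [|now apply Rmult_lt_0_compat].
    rewrite !ln_mult in W by (try assumption; apply Rpower_pos).
    rewrite ln_Rpower in W.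
    assert (L := ln_add_le w h Hw ltac:(lra)).
    assert (0 <= h / w) by (apply Rdiv_le_0_compat; lra).
    assert (ln w <= ln (w + h)) by (apply ln_le; lra). nra.
  - assert (W := Gamma_int_wendel w h Hw Hh).
    apply ln_le in W; [|assumption].
    rewrite ln_mult, ln_Rpower in W by (try assumption; apply Rpower_pos). lra.
Qed.

Lemma ln_Gamma_int_shift x y n : 0 < x -> 0 < y -> Rabs (y - x) <= 1 ->
  Rabs (ln (Gamma_int (y + INR (S n))) - ln (Gamma_int (x + INR (S n)))
    - (y - x) * ln (x + INR (S n))) <= 2 / INR (S n) * Rabs (y - x).
Proof.
  intros Hx Hy H. set (N := INR (S n)).
  assert (HN : 0 < N) by (apply lt_0_INR; lia).
  assert (inv : forall w, N <= w -> 0 <= / w <= / N).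
  { intros w Hw; split; [left; apply Rinv_0_lt_compat; lra|apply Rinv_le_contravar; lra]. }
  destruct (Rle_lt_dec x y) as [C|C].
  - rewrite (Rabs_pos_eq (y - x)) in * by lra.
    assert (B := ln_Gamma_int_increment (x + N) (y - x) ltac:(lra) ltac:(lra)).
    replace (x + N + (y - x)) with (y + N) in B by ring.
    assert (I := inv (x + N) ltac:(lra)). unfold Rdiv in *.
    apply Rabs_le; nra.
  (* The increment now starts at y, so the logarithm has to be moved from y + N to x + N. This costs
     at most another (x - y)/N, whence the constant 2. *)
  - rewrite (Rabs_left1 (y - x)) in * by lra.
    assert (B := ln_Gamma_int_increment (y + N) (x - y) ltac:(lra) ltac:(lra)).
    assert (L := ln_add_le (y + N) (x - y) ltac:(lra) ltac:(lra)).
    assert (L' : ln (y + N) <= ln (x + N)) by (apply ln_le; lra).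
    replace (y + N + (x - y)) with (x + N) in B, L by ring.
    assert (I := inv (y + N) ltac:(lra)). unfold Rdiv in *.
    assert ((x - y) * / (y + N) <= / N) by nra.
    set (D := ln (x + N) - ln (y + N)) in *.
    assert ((x - y) * D <= (x - y) * / N) by (apply Rmult_le_compat_l; lra).
    assert (0 <= (x - y) * D) by (apply Rmult_le_pos; unfold D; lra).
    assert (E : (x - y) * ln (x + N) = (x - y) * ln (y + N) + (x - y) * D)
      by (unfold D; ring).
    apply Rabs_le; nra.
Qed.

Lemma is_lim_seq_div_S (c : R) : is_lim_seq (fun n => c / INR (S n)) 0.
Proof.
  replace (Finite 0) with (Rbar_mult c 0) by (simpl; f_equal; ring).
  apply (is_lim_seq_scal_l (fun n => / INR (S n)) c 0).
  apply (is_lim_seq_incr_1 (fun n => / INR n)).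
  replace (Finite 0) with (Rbar_inv p_infty) by reflexivity.
  apply is_lim_seq_inv; [apply is_lim_seq_INR|easy].
Qed.

(** ln Gamma(y) is ln Gamma(y + N) - ln (y)_N. Far out, the first term is linear in y with slope
    ln(x + N), up to 2 |y - x| / N, so the explicit remainder serves as approximant. *)
Lemma ex_derive_ln_Gamma_int x : 0 < x -> ex_derive (fun y => ln (Gamma_int y)) x.
Proof.
  intros Hx.
  apply ex_derive_of_approx
    with (phi := fun n y => y * ln (x + INR (S n)) - ln (poch y (S n)))
         (dphi := fun n => ln (x + INR (S n)) - harm x (S n))
         (eps := fun n => 2 / INR (S n)).
  - intros n; assert (P := poch_pos x (S n) Hx).
    apply (is_derive_minus (V := R_NormedModule)
      (fun y => y * ln (x + INR (S n))) (fun y => ln (poch y (S n)))).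
    + generalize (ln (x + INR (S n))); intros c; auto_derive; [easy|ring].
    + evar_last.
      * apply (is_derive_comp (V := R_NormedModule) ln (fun y => poch y (S n)));
          [apply is_derive_ln; exact P|now apply is_derive_poch].
      * change (poch x (S n) * harm x (S n) * / poch x (S n) = harm x (S n)).
        rewrite Rmult_comm, <- Rmult_assoc, Rinv_l, Rmult_1_l by lra; reflexivity.
  - apply is_lim_seq_div_S.
  - intros n; apply locally_R_iff; exists (Rmin x 1); split; [apply Rmin_pos; lra|].
    intros y Hy; assert (B1 := Rmin_l x 1); assert (B2 := Rmin_r x 1).
    assert (Hy0 : 0 < y).
    { assert (Hy' : Rabs (y - x) < x) by lra. apply Rabs_def2 in Hy'; lra. }
    assert (S1 := ln_Gamma_int_shift x y n Hx Hy0 ltac:(lra)).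
    rewrite !Gamma_int_poch, !ln_mult in S1 by (auto using poch_pos, Gamma_int_pos).
    replace (ln (Gamma_int y) - ln (Gamma_int x)
      - (y * ln (x + INR (S n)) - ln (poch y (S n))
        - (x * ln (x + INR (S n)) - ln (poch x (S n)))))
      with (ln (poch y (S n)) + ln (Gamma_int y) - (ln (poch x (S n)) + ln (Gamma_int x))
        - (y - x) * ln (x + INR (S n))) by ring.
    exact S1.
Qed.

Lemma Gamma_eq_Gamma_int x : 0 < x -> Gamma x = Gamma_int x.
Proof.
  intros Hx; unfold Gamma.
  replace (Z.to_nat (up (- x))) with O.
  - simpl; rewrite Rplus_0_r; field.
  - destruct (archimed (- x)) as [_ H].
    assert (H1 : IZR (up (- x)) < 1) by lra. apply lt_IZR in H1; lia.
Qed.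

Lemma locally_pos x : 0 < x -> locally x (fun y => 0 < y).
Proof.
  intros Hx; apply locally_R_iff; exists x; split; [exact Hx|].
  intros y Hy; apply Rabs_def2 in Hy; lra.
Qed.

Lemma ex_derive_Gamma x : 0 < x -> ex_derive Gamma x.
Proof.
  intros Hx; apply (ex_derive_ext_loc (fun y => exp (ln (Gamma_int y)))).
  - apply filter_imp with (2 := locally_pos x Hx); intros y Hy.
    rewrite exp_ln by (now apply Gamma_int_pos). symmetry; now apply Gamma_eq_Gamma_int.
  - apply (ex_derive_comp exp (fun y => ln (Gamma_int y)));
      [auto_derive; easy|now apply ex_derive_ln_Gamma_int].
Qed.

Lemma Gamma_pos x : 0 < x -> 0 < Gamma x.
Proof. intros Hx; rewrite Gamma_eq_Gamma_int; auto using Gamma_int_pos. Qed.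

(* At negative integers both sides are the junk value 0. *)
Lemma Gamma_S x : x <> 0 -> Gamma (x + 1) = x * Gamma x.
Proof.
  intros Hx0; destruct (Rlt_le_dec 0 x) as [Hx|Hx].
  - rewrite !Gamma_eq_Gamma_int by lra; now apply Gamma_int_S.
  - unfold Gamma.
    (* Passing from x to x + 1 saves exactly one shift, so both values rest on the same Euler
       integral; [U0] excludes truncation in [Z.to_nat]. *)
    assert (U : up (- x) = (up (- (x + 1)) + 1)%Z).
    { symmetry; apply tech_up; rewrite plus_IZR; destruct (archimed (- (x + 1))); lra. }
    assert (U0 : (0 <= up (- (x + 1)))%Z).
    { destruct (archimed (- (x + 1))) as [H _].
      assert (H1 : -1 < IZR (up (- (x + 1)))) by lra. apply lt_IZR in H1; lia. }
    rewrite U, Z2Nat.inj_add, Nat.add_1_r, poch_S_l, S_INR by lia.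
    set (n := Z.to_nat (up (- (x + 1)))).
    replace (x + (INR n + 1)) with (x + 1 + INR n) by ring.
    unfold Rdiv; rewrite Rinv_mult.
    transitivity (x * / x * (Gamma_int (x + 1 + INR n) * / poch (x + 1) n)); [|ring].
    rewrite Rinv_r by assumption; ring.
Qed.

Lemma Gamma_poch x k : (forall j, (j < k)%nat -> x + INR j <> 0) ->
  Gamma (x + INR k) = poch x k * Gamma x.
Proof.
  induction k as [|k IH]; intros H.
  - simpl; rewrite Rplus_0_r; ring.
  - rewrite S_INR, <- Rplus_assoc, Gamma_S, IH by auto. simpl; ring.
Qed.

(** * Cosine moments and the sine product *)

Definition cos_moment (n : nat) (s : R) : R :=
  RInt (fun t => cos (2 * s * t) * cos t ^ n) 0 (PI / 2).

Lemma cos_pow_continuous n s t : continuous (fun t => cos (2 * s * t) * cos t ^ n) t.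
Proof.
  apply (ex_derive_continuous (V := R_NormedModule)); auto_derive; easy.
Qed.

Lemma ex_cos_moment n s : ex_RInt (fun t => cos (2 * s * t) * cos t ^ n) 0 (PI / 2).
Proof.
  apply (ex_RInt_continuous (V := R_CompleteNormedModule)); intros t _.
  apply cos_pow_continuous.
Qed.

(** Two integrations by parts, done at once with an explicit primitive. For n + 2 = 2k the left
    factor is 4 k^2 (1 - s^2/k^2), one factor of the sine product. *)
Lemma cos_moment_rec n s :
  (INR (n + 2) ^ 2 - 4 * s ^ 2) * cos_moment (n + 2) s
  = INR (n + 2) * INR (n + 1) * cos_moment n s.
Proof.
  apply Rminus_diag_uniq.
  (* W vanishes at both ends and its derivative is the integrand of the difference. *)
  set (W := fun t => INR (n + 2) * (cos (2 * s * t) * cos t ^ (n + 1) * sin t)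
    - 2 * s * (sin (2 * s * t) * cos t ^ (n + 2))).
  set (dW := fun t => minus (scal (INR (n + 2) ^ 2 - 4 * s ^ 2)
      (cos (2 * s * t) * cos t ^ (n + 2)))
    (scal (INR (n + 2) * INR (n + 1)) (cos (2 * s * t) * cos t ^ n))).
  assert (I : is_RInt dW 0 (PI / 2) (minus (scal (INR (n + 2) ^ 2 - 4 * s ^ 2)
      (cos_moment (n + 2) s)) (scal (INR (n + 2) * INR (n + 1)) (cos_moment n s)))).
  { apply (is_RInt_minus (V := R_NormedModule)); apply (is_RInt_scal (V := R_NormedModule));
      apply (RInt_correct (V := R_CompleteNormedModule)), ex_cos_moment. }
  assert (I' : is_RInt dW 0 (PI / 2) (minus (W (PI / 2)) (W 0))).
  { apply (is_RInt_derive (V := R_CompleteNormedModule)).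
    - intros t _; unfold W, dW, minus, plus, opp, scal; simpl; unfold mult; simpl.
      rewrite (Nat.add_comm n 2), (Nat.add_comm n 1). cbn [Nat.add].
      assert (S2 : sin t * sin t = 1 - cos t * cos t)
        by (assert (H := sin2_cos2 t); unfold Rsqr in H; lra).
      auto_derive; [easy|]. cbn [Nat.pred pow].
      change (match n with O => 1 | S _ => INR n + 1 end) with (INR (S n)).
      rewrite ?S_INR.
      ring_simplify. replace (sin t ^ 2) with (1 - cos t * cos t) by (rewrite <- S2; ring).
      ring.
    - intros t _; unfold dW; apply (continuous_minus (V := R_NormedModule));
        apply (continuous_scal_r (V := R_NormedModule)), cos_pow_continuous. }
  assert (E := is_RInt_unique _ _ _ _ I); rewrite (is_RInt_unique _ _ _ _ I') in E.
  transitivity (W (PI / 2) - W 0); [symmetry; exact E|unfold W].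
  rewrite Rmult_0_r, cos_PI2, sin_0, !pow_ne_zero by lia; ring.
Qed.

Lemma cos_moment_0 s : s <> 0 -> cos_moment 0 s = sin (PI * s) / (2 * s).
Proof.
  intros Hs; unfold cos_moment.
  assert (I : is_RInt (fun t => cos (2 * s * t) * cos t ^ 0) 0 (PI / 2)
    (minus (sin (2 * s * (PI / 2)) / (2 * s)) (sin (2 * s * 0) / (2 * s)))).
  { apply (is_RInt_derive (V := R_CompleteNormedModule) (fun t => sin (2 * s * t) / (2 * s))).
    - intros t _; auto_derive; [easy|simpl; field; auto].
    - intros t _; apply cos_pow_continuous. }
  rewrite (is_RInt_unique _ _ _ _ I); unfold minus, plus, opp; simpl.
  rewrite Rmult_0_r, sin_0. replace (2 * s * (PI / 2)) with (PI * s) by field. field; auto.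
Qed.

Lemma cos_moment_0_0 : cos_moment 0 0 = PI / 2.
Proof.
  unfold cos_moment.
  rewrite (RInt_ext _ (fun _ => 1)).
  - rewrite RInt_const; unfold scal; simpl; unfold mult; simpl; ring.
  - intros t _; rewrite Rmult_0_r, Rmult_0_l, cos_0; simpl; ring.
Qed.

(** This is t <= tan t free of division: sin t - t cos t has derivative t sin t >= 0. *)
Lemma mult_cos_le_sin t : 0 <= t <= PI / 2 -> t * cos t <= sin t.
Proof.
  intros Ht.
  destruct (MVT_gen (fun t => sin t - t * cos t) 0 t (fun t => t * sin t)) as (c & Hc & E).
  - intros u _; auto_derive; [easy|ring].
  - intros u _; apply continuity_pt_filterlim.
    apply (ex_derive_continuous (V := R_NormedModule) (fun t => sin t - t * cos t)).
    auto_derive; easy.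
  - rewrite Rmin_left, Rmax_right in Hc by lra. rewrite sin_0, Rmult_0_l in E.
    assert (0 <= sin c) by (apply sin_ge_0; lra).
    assert (0 <= c * sin c * (t - 0)) by (apply Rmult_le_pos; [apply Rmult_le_pos|]; lra).
    lra.
Qed.

Lemma sin_sqr_le x : sin x * sin x <= x * x.
Proof.
  destruct (MVT_gen sin 0 x cos) as (c & _ & E).
  - intros u _; apply is_derive_sin.
  - intros u _; apply continuity_sin.
  - rewrite sin_0, !Rminus_0_r in E; rewrite E.
    assert (H := sin2_cos2 c); unfold Rsqr in H.
    assert (0 <= sin c * sin c) by apply Rle_0_sqr.
    assert (0 <= x * x) by apply Rle_0_sqr. nra.
Qed.

Lemma cos_moment_0_pos n : 0 < cos_moment (2 * n) 0.
Proof.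
  induction n as [|n IH].
  - simpl Nat.mul; rewrite cos_moment_0_0; assert (H := PI_RGT_0); lra.
  - replace (2 * S n)%nat with (2 * n + 2)%nat by lia.
    assert (R := cos_moment_rec (2 * n) 0).
    assert (P2 : 0 < INR (2 * n + 2)) by (apply lt_0_INR; lia).
    assert (P1 : 0 < INR (2 * n + 1)) by (apply lt_0_INR; lia).
    replace (INR (2 * n + 2) ^ 2 - 4 * 0 ^ 2) with (INR (2 * n + 2) * INR (2 * n + 2))
      in R by ring.
    assert (0 < INR (2 * n + 2) * INR (2 * n + 1) * cos_moment (2 * n) 0)
      by (repeat apply Rmult_lt_0_compat; assumption).
    apply Rmult_lt_reg_l with (INR (2 * n + 2) * INR (2 * n + 2)); nra.
Qed.

(** Pointwise 1 - cos(2 s t) = 2 sin(s t)^2 <= 2 s^2 t^2. The factor t^2 is absorbed by t^2 cos(t)^2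
    <= 1 - cos(t)^2, which turns the bound into a difference of consecutive moments at s = 0. *)
Lemma cos_moment_close n s :
  0 <= cos_moment (2 * S n) 0 - cos_moment (2 * S n) s
    <= 2 * s ^ 2 * (cos_moment (2 * n) 0 - cos_moment (2 * S n) 0).
Proof.
  unfold cos_moment.
  assert (E1 := ex_cos_moment (2 * S n) 0); assert (E2 := ex_cos_moment (2 * S n) s).
  assert (E3 := ex_cos_moment (2 * n) 0). assert (HPI := PI_RGT_0).
  rewrite <- !(RInt_minus (V := R_CompleteNormedModule)) by assumption.
  rewrite <- (RInt_scal (V := R_CompleteNormedModule) _ _ _ (2 * s ^ 2))
    by (apply (ex_RInt_minus (V := R_NormedModule)); assumption).
  assert (pw : forall t, 0 < t < PI / 2 -> 0 <= 1 - cos (2 * s * t) <= 2 * (s * t) ^ 2).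
  { intros t _. replace (2 * s * t) with (2 * (s * t)) by ring.
    rewrite cos_2a_sin. assert (Q := sin_sqr_le (s * t)).
    assert (0 <= sin (s * t) * sin (s * t)) by apply Rle_0_sqr.
    simpl; lra. }
  split.
  - apply RInt_ge_0; [lra|apply (ex_RInt_minus (V := R_NormedModule)); assumption|].
    intros t Ht.
    change (0 <= cos (2 * 0 * t) * cos t ^ (2 * S n) - cos (2 * s * t) * cos t ^ (2 * S n)).
    rewrite Rmult_0_r, Rmult_0_l, cos_0.
    assert (H := pw t Ht). rewrite <- Rmult_minus_distr_r.
    apply Rmult_le_pos; [lra|]. left; apply pow_lt, cos_gt_0; lra.
  - apply RInt_le; [lra|apply (ex_RInt_minus (V := R_NormedModule)); assumption| |].
    + apply (ex_RInt_scal (V := R_NormedModule)), (ex_RInt_minus (V := R_NormedModule)); assumption.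
    + intros t Ht.
      change (cos (2 * 0 * t) * cos t ^ (2 * S n) - cos (2 * s * t) * cos t ^ (2 * S n)
        <= 2 * s ^ 2 * (cos (2 * 0 * t) * cos t ^ (2 * n)
             - cos (2 * 0 * t) * cos t ^ (2 * S n))).
      rewrite Rmult_0_r, Rmult_0_l, cos_0.
      replace (2 * S n)%nat with (S (S (2 * n))) by lia. cbn [pow].
      assert (H := pw t Ht).
      assert (P : 0 < cos t ^ (2 * n)) by (apply pow_lt, cos_gt_0; lra).
      assert (C := cos_gt_0 t ltac:(lra) ltac:(lra)).
      assert (M := mult_cos_le_sin t ltac:(lra)).
      assert (M2 : (t * cos t) * (t * cos t) <= sin t * sin t)
        by (apply Rmult_le_compat; nra).
      assert (S2 := sin2_cos2 t); unfold Rsqr in S2.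
      set (p := cos t ^ (2 * n)) in *.
      apply Rle_trans with ((2 * (s * t) ^ 2) * (cos t * cos t * p)).
      * replace (1 * (cos t * (cos t * p)) - cos (2 * s * t) * (cos t * (cos t * p)))
          with ((1 - cos (2 * s * t)) * (cos t * cos t * p)) by ring.
        apply Rmult_le_compat_r; [apply Rlt_le; repeat apply Rmult_lt_0_compat; assumption|lra].
      * replace (2 * (s * t) ^ 2 * (cos t * cos t * p))
          with (2 * (s * s) * p * ((t * cos t) * (t * cos t))) by ring.
        replace (2 * (s * (s * 1)) * (1 * p - 1 * (cos t * (cos t * p))))
          with (2 * (s * s) * p * (1 - cos t * cos t)) by ring.
        apply Rmult_le_compat_l; [|lra].
        assert (0 <= s * s) by apply Rle_0_sqr. nra.
Qed.

Fixpoint sine_prod (s : R) (n : nat) : R :=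
  match n with O => 1 | S k => sine_prod s k * (1 - s ^ 2 / INR n ^ 2) end.

(** Dividing the recurrence at s by the one at 0 moves one factor into the product, so the
    expression does not depend on n; at n = 0 both moments are explicit. *)
Lemma sine_prod_cos_moment n s : 0 < s ->
  sine_prod s n * (cos_moment (2 * n) s / cos_moment (2 * n) 0) = sin (PI * s) / (PI * s).
Proof.
  intros Hs; assert (HPI := PI_RGT_0); induction n as [|n IH].
  - simpl sine_prod; simpl Nat.mul. rewrite cos_moment_0, cos_moment_0_0 by lra; field; lra.
  - rewrite <- IH; simpl sine_prod.
    replace (2 * S n)%nat with (2 * n + 2)%nat by lia.
    assert (R0 := cos_moment_rec (2 * n) 0); assert (Rs := cos_moment_rec (2 * n) s).
    assert (P0 := cos_moment_0_pos n); assert (P1 := cos_moment_0_pos (S n)).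
    replace (2 * S n)%nat with (2 * n + 2)%nat in P1 by lia.
    replace (match n with O => 1 | S _ => INR n + 1 end) with (INR (S n)) by reflexivity.
    assert (Hn : 0 < INR (S n)) by (apply lt_0_INR; lia).
    assert (H1 : 0 < INR (2 * n + 1)) by (apply lt_0_INR; lia).
    replace (INR (2 * n + 2)) with (2 * INR (S n)) in R0, Rs
      by (rewrite plus_INR, mult_INR, S_INR; simpl; ring).
    set (N := INR (S n)) in *; set (q := INR (2 * n + 1)) in *.
    set (As := cos_moment (2 * n) s) in *; set (A0 := cos_moment (2 * n) 0) in *.
    set (Bs := cos_moment (2 * n + 2) s) in *; set (B0 := cos_moment (2 * n + 2) 0) in *.
    assert (E0 : A0 = 2 * N * B0 / q).
    { apply Rmult_eq_reg_l with (2 * N * q); [|nra].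
      replace (2 * N * q * (2 * N * B0 / q)) with (((2 * N) ^ 2 - 4 * 0 ^ 2) * B0)
        by (field; lra). now rewrite R0. }
    assert (Es : As = ((2 * N) ^ 2 - 4 * s ^ 2) * Bs / (2 * N * q)).
    { apply Rmult_eq_reg_l with (2 * N * q); [|nra].
      replace (2 * N * q * (((2 * N) ^ 2 - 4 * s ^ 2) * Bs / (2 * N * q)))
        with (((2 * N) ^ 2 - 4 * s ^ 2) * Bs) by (field; lra). now rewrite Rs. }
    rewrite Es, E0; field; repeat split; lra.
Qed.

(** It remains to see that the ratio of moments tends to 1; it is squeezed between 1 - 2 s^2 / N and
    1. *)
Lemma sine_prod_limit s : 0 < s -> is_lim_seq (sine_prod s) (sin (PI * s) / (PI * s)).
Proof.
  intros Hs.
  set (r := fun n => cos_moment (2 * S n) s / cos_moment (2 * S n) 0).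
  assert (Hr : is_lim_seq r 1).
  { apply is_lim_seq_le_le with (u := fun n => 1 - 2 * s ^ 2 / INR (S n)) (w := fun _ => 1).
    - intros n; assert (C := cos_moment_close n s).
      assert (P := cos_moment_0_pos (S n)); assert (R0 := cos_moment_rec (2 * n) 0).
      replace (2 * n + 2)%nat with (2 * S n)%nat in R0 by lia.
      unfold r; set (Bs := cos_moment (2 * S n) s) in *; set (B0 := cos_moment (2 * S n) 0) in *.
      set (A0 := cos_moment (2 * n) 0) in *.
      replace (INR (2 * S n)) with (2 * INR (S n)) in R0 by (rewrite mult_INR; simpl; ring).
      replace (INR (2 * n + 1)) with (2 * INR (S n) - 1) in R0
        by (rewrite plus_INR, mult_INR, S_INR; simpl; ring).
      assert (Hn : 1 <= INR (S n)) by (rewrite S_INR; assert (H := pos_INR n); lra).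
      set (N := INR (S n)) in *.
      (* At s = 0 the recurrence reads 2 N B0 = (2 N - 1) A0, so A0 - B0 = B0 / (2 N - 1). *)
      assert (D : A0 - B0 <= B0 / N).
      { replace A0 with (2 * N * B0 / (2 * N - 1)).
        - replace (2 * N * B0 / (2 * N - 1) - B0) with (B0 * / (2 * N - 1)) by (field; lra).
          apply Rmult_le_compat_l; [lra|apply Rinv_le_contravar; lra].
        - apply Rmult_eq_reg_l with (2 * N * (2 * N - 1)); [|nra].
          rewrite <- R0; field; lra. }
      assert (Q : 0 <= s ^ 2) by apply pow2_ge_0.
      assert (D2 : 2 * s ^ 2 * (A0 - B0) <= 2 * s ^ 2 * (B0 / N))
        by (apply Rmult_le_compat_l; lra).
      split.
      + apply Rmult_le_reg_r with B0; [exact P|].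
        replace (Bs / B0 * B0) with Bs by (field; lra).
        replace ((1 - 2 * s ^ 2 / N) * B0) with (B0 - 2 * s ^ 2 * (B0 / N)) by (field; lra).
        lra.
      + apply Rmult_le_reg_r with B0; [exact P|].
        replace (Bs / B0 * B0) with Bs by (field; lra). lra.
    - replace (Finite 1) with (Finite (1 - 0)) by (f_equal; ring).
      apply is_lim_seq_minus'; [apply is_lim_seq_const|apply is_lim_seq_div_S].
    - apply is_lim_seq_const. }
  apply is_lim_seq_incr_1.
  assert (L : is_lim_seq (fun n => (sin (PI * s) / (PI * s)) * / r n)
     (sin (PI * s) / (PI * s))).
  { replace (Finite (sin (PI * s) / (PI * s)))
      with (Rbar_mult (sin (PI * s) / (PI * s)) (Rbar_inv 1))
      by (simpl; f_equal; field; assert (HPI := PI_RGT_0); lra).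
    apply is_lim_seq_scal_l, is_lim_seq_inv; [exact Hr|]. intros E; injection E; lra. }
  (* The sequences agree only where [r n] is nonzero, which is certain once it lies within 1 of its
     limit 1. *)
  apply is_lim_seq_ext_loc with (2 := L).
  apply is_lim_seq_spec in Hr; destruct (Hr (mkposreal 1 Rlt_0_1)) as [N HN].
  exists N; intros n Hn; specialize (HN n Hn); simpl in HN.
  rewrite <- (sine_prod_cos_moment (S n) s Hs).
  change (cos_moment (2 * S n) s / cos_moment (2 * S n) 0) with (r n).
  field. intros E; rewrite E in HN; apply Rabs_def2 in HN; lra.
Qed.

(** Offset by one, the two products pair k + s with k - s, which gives k^2 (1 - s^2/k^2); the first
    factor s and the last factor n + 1 - s stay unpaired. *)
Lemma poch_sine_prod s n : poch s (S n) * poch (1 - s) (S n)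
  = INR (fact n) ^ 2 * s * sine_prod s n * (INR n + 1 - s).
Proof.
  induction n as [|n IH].
  - simpl; ring.
  - change (poch s (S (S n)) * poch (1 - s) (S (S n)))
      with (poch s (S n) * (s + INR (S n)) * (poch (1 - s) (S n) * (1 - s + INR (S n)))).
    transitivity (poch s (S n) * poch (1 - s) (S n)
      * ((s + INR (S n)) * (1 - s + INR (S n)))); [ring|].
    rewrite IH. change (fact (S n)) with (S n * fact n)%nat; rewrite mult_INR.
    cbn [sine_prod]. assert (H : INR (S n) <> 0) by (apply not_0_INR; lia).
    rewrite S_INR in *. field; exact H.
Qed.

(** Gauss' limit: the increment bounds at the integer N = n + 1, where Gamma(N) = n!, leave an error
    of at most s/N in the logarithm. *)
Lemma Gamma_int_ratio_limit s : 0 <= s <= 1 ->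
  is_lim_seq (fun n => Gamma_int (s + INR (S n))
    / (Rpower (INR (S n)) s * INR (fact n))) 1.
Proof.
  intros Hs.
  apply is_lim_seq_ext with (u := fun n => exp (ln (Gamma_int (INR (S n) + s))
    - ln (Gamma_int (INR (S n))) - s * ln (INR (S n)))).
  - intros n. assert (P := pos_INR n). assert (PS : 0 < INR (S n)) by (rewrite S_INR; lra).
    replace (INR (fact n)) with (Gamma_int (INR (S n))) by (rewrite S_INR; apply Gamma_int_nat).
    unfold Rminus; rewrite !exp_plus, !exp_Ropp, !exp_ln by (apply Gamma_int_pos; lra).
    rewrite (Rplus_comm s). unfold Rpower, Rdiv. rewrite Rinv_mult. ring.
  - replace 1 with (exp 0) by apply exp_0.
    apply is_lim_seq_continuous; [apply derivable_continuous_pt, derivable_pt_exp|].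
    apply is_lim_seq_le_le with (u := fun n => - s / INR (S n)) (w := fun _ => 0).
    + intros n. assert (PS : 0 < INR (S n)) by (apply lt_0_INR; lia).
      assert (B := ln_Gamma_int_increment (INR (S n)) s PS Hs).
      unfold Rdiv in *; rewrite Ropp_mult_distr_l_reverse; lra.
    + apply is_lim_seq_div_S.
    + apply is_lim_seq_const.
Qed.

(** In the product of Gauss' limits at s and 1 - s the powers N^s and N^(1 - s) combine to N, and
    the Pochhammer symbols form the sine product. Uniqueness of the limit gives the formula. *)
Lemma Gamma_int_reflection s : 0 < s < 1 ->
  Gamma_int s * Gamma_int (1 - s) * sin (PI * s) = PI.
Proof.
  intros Hs; assert (HPI := PI_RGT_0).
  assert (L1 := Gamma_int_ratio_limit s ltac:(lra)).
  assert (L2 := Gamma_int_ratio_limit (1 - s) ltac:(lra)).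
  assert (L := is_lim_seq_mult' _ _ _ _ L1 L2).
  assert (L3 : is_lim_seq (fun n => Gamma_int s * Gamma_int (1 - s) * s
      * (sine_prod s n * (1 - s / INR (S n))))
    (Gamma_int s * Gamma_int (1 - s) * s * (sin (PI * s) / (PI * s) * (1 - 0)))).
  { apply (is_lim_seq_scal_l _ (Gamma_int s * Gamma_int (1 - s) * s)
      (Finite (sin (PI * s) / (PI * s) * (1 - 0)))).
    apply is_lim_seq_mult'; [apply sine_prod_limit; lra|].
    apply is_lim_seq_minus'; [apply is_lim_seq_const|apply is_lim_seq_div_S]. }
  apply is_lim_seq_ext with (v := fun n => Gamma_int s * Gamma_int (1 - s) * s
      * (sine_prod s n * (1 - s / INR (S n)))) in L.
  - assert (E : Finite (1 * 1) = Finite (Gamma_int s * Gamma_int (1 - s) * s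
        * (sin (PI * s) / (PI * s) * (1 - 0)))).
    { rewrite <- (is_lim_seq_unique _ _ L). apply (is_lim_seq_unique _ _ L3). }
    injection E; intros E1.
    transitivity (PI * (1 * 1)); [rewrite E1; field; lra|ring].
  - intros n. rewrite !Gamma_int_poch by lra.
    assert (PS : 0 < INR (S n)) by (apply lt_0_INR; lia).
    assert (Hp := Rpower_pos (INR (S n)) s); assert (Hq := Rpower_pos (INR (S n)) (1 - s)).
    assert (HF := INR_fact_lt_0 n).
    assert (E : Rpower (INR (S n)) s * Rpower (INR (S n)) (1 - s) = INR (S n)).
    { rewrite <- Rpower_plus. replace (s + (1 - s)) with 1 by ring. now apply Rpower_1. }
    transitivity (poch s (S n) * poch (1 - s) (S n) * (Gamma_int s * Gamma_int (1 - s))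
      / (Rpower (INR (S n)) s * Rpower (INR (S n)) (1 - s) * INR (fact n) ^ 2));
      [field; repeat split; lra|].
    rewrite poch_sine_prod, E.
    replace (INR n + 1) with (INR (S n)) by apply S_INR.
    field; split; lra.
Qed.

(** Induction on the integer part: from x to x + 1 the first factor gains x, the second loses -x,
    and the sine changes sign. *)
Lemma Gamma_reflection nu : 0 < nu -> (forall n : Z, nu <> IZR n) ->
  Gamma nu * Gamma (1 - nu) * sin (PI * nu) = PI.
Proof.
  intros Hn HZ; destruct (nfloor_ex nu (Rlt_le _ _ Hn)) as [n Hfl].
  assert (H0 : nu <> INR n) by (rewrite INR_IZR_INZ; apply HZ).
  replace nu with (nu - INR n + INR n) by ring.
  assert (Hs : 0 < nu - INR n < 1) by lra.
  set (s := nu - INR n) in *; clearbody s; clear - Hs.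
  induction n as [|n IH].
  - simpl; rewrite Rplus_0_r, !Gamma_eq_Gamma_int by lra. now apply Gamma_int_reflection.
  - rewrite S_INR. assert (P := pos_INR n).
    replace (s + (INR n + 1)) with (s + INR n + 1) by ring.
    set (x := s + INR n) in *. refine (eq_trans _ IH).
    rewrite (Rmult_plus_distr_l PI x 1), Rmult_1_r, neg_sin, (Gamma_S x) by (unfold x; lra).
    replace (1 - x) with (- x + 1) by ring. rewrite (Gamma_S (- x)) by (unfold x; lra).
    replace (1 - (x + 1)) with (- x) by ring. ring.
Qed.

(** * Entire series at a complex point *)

(** Absolute summability at every radius dominates the real and the imaginary part of the series at
    any complex point. *)
Definition entire (a : nat -> R) : Prop :=
  forall r, 0 <= r -> ex_series (fun k => Rabs (a k) * r ^ k).

Lemma ex_series_Rle (a b : nat -> R) :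
  (forall n, Rabs (a n) <= b n) -> ex_series b -> ex_series a.
Proof. exact (ex_series_le (V := R_CompleteNormedModule) a b). Qed.

Lemma ex_series_Rext (a b : nat -> R) :
  (forall n, a n = b n) -> ex_series a -> ex_series b.
Proof. exact (ex_series_ext (V := R_NormedModule) a b). Qed.

Lemma entire_le a b : (forall n, Rabs (a n) <= Rabs (b n)) -> entire b -> entire a.
Proof.
  intros H Hb r Hr; apply ex_series_Rle with (2 := Hb r Hr); intros n.
  assert (P := pow_le r n Hr).
  rewrite Rabs_mult, Rabs_Rabsolu, (Rabs_pos_eq (r ^ n)) by assumption.
  now apply Rmult_le_compat_r.
Qed.

Lemma entire_add a b : entire a -> entire b -> entire (seq_add a b).
Proof.
  intros Ha Hb r Hr.
  apply ex_series_Rle with (b := fun k => Rabs (a k) * r ^ k + Rabs (b k) * r ^ k).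
  - intros n; assert (P := pow_le r n Hr).
    rewrite Rabs_mult, Rabs_Rabsolu, (Rabs_pos_eq (r ^ n)) by assumption.
    rewrite <- Rmult_plus_distr_r; apply Rmult_le_compat_r; [assumption|apply Rabs_triang].
  - exact (ex_series_plus (V := R_NormedModule) _ _ (Ha r Hr) (Hb r Hr)).
Qed.

Lemma entire_scal c a : entire a -> entire (fun k => c * a k).
Proof.
  intros Ha r Hr.
  apply ex_series_Rext with (fun k => Rabs c * (Rabs (a k) * r ^ k)).
  - intros n; rewrite Rabs_mult; ring.
  - exact (ex_series_scal (V := R_NormedModule) (Rabs c) _ (Ha r Hr)).
Qed.

Lemma entire_sub a b : entire a -> entire b -> entire (seq_sub a b).
Proof.
  intros Ha Hb; replace (seq_sub a b) with (seq_add a (fun k => -1 * b k)).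
  - apply entire_add, entire_scal; assumption.
  - apply functional_extensionality; intros n; unfold seq_add, seq_sub; ring.
Qed.

Lemma entire_shift a : entire a -> entire (shift a).
Proof.
  intros Ha r Hr.
  assert (Hr1 : 0 <= r + 1) by lra.
  apply ex_series_Rle with (b := fun k => Rabs (a (S k)) * (r + 1) ^ S k).
  - intros n; assert (P := pow_le r n Hr); unfold shift.
    rewrite Rabs_mult, Rabs_Rabsolu, (Rabs_pos_eq (r ^ n)) by assumption.
    apply Rmult_le_compat_l; [apply Rabs_pos|].
    assert (Q : r ^ n <= (r + 1) ^ n) by (apply pow_incr; lra). simpl; nra.
  - exact (proj1 (ex_series_incr_1 (V := R_NormedModule)
      (fun k => Rabs (a k) * (r + 1) ^ k)) (Ha _ Hr1)).
Qed.

Lemma entire_const c : entire (seq_const c).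
Proof.
  intros r Hr; apply ex_series_incr_1; simpl.
  apply ex_series_Rext with (fun _ => 0).
  - intros n; rewrite Rabs_R0; now rewrite Rmult_0_l.
  - exists 0; unfold is_series; apply filterlim_ext with (fun _ => 0);
      [|apply filterlim_const].
    intros n; now rewrite sum_n_const, Rmult_0_r.
Qed.

Lemma entire_conv a b : entire a -> entire b -> entire (conv a b).
Proof.
  intros Ha Hb r Hr.
  assert (abs : forall c, entire c -> ex_series (fun k => Rabs (Rabs (c k) * r ^ k))).
  { intros c Hc; apply ex_series_Rext with (2 := Hc r Hr); intros n.
    symmetry; apply Rabs_pos_eq.
    apply Rmult_le_pos; [apply Rabs_pos|now apply pow_le]. }
  assert (M := is_series_mult _ _ _ _ (Series_correct _ (Ha r Hr)) (Series_correct _ (Hb r Hr))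
    (abs a Ha) (abs b Hb)).
  apply ex_series_Rle with (2 := ex_intro _ _ M); intros n.
  assert (P := pow_le r n Hr).
  rewrite Rabs_mult, Rabs_Rabsolu, (Rabs_pos_eq (r ^ n)), conv_PS_mult by assumption.
  unfold PS_mult.
  apply Rle_trans with (sum_f_R0 (fun k => Rabs (a k * b (n - k)%nat)) n * r ^ n).
  - apply Rmult_le_compat_r; [assumption|apply Rsum_abs].
  - rewrite Rmult_comm, scal_sum; right; apply sum_eq; intros k Hk.
    rewrite Rabs_mult. replace (r ^ n) with (r ^ k * r ^ (n - k))
      by (rewrite <- pow_add; f_equal; lia). ring.
Qed.

Lemma entire_of_theta c : entire (theta c) -> entire c.
Proof.
  intros H; replace c with (seq_add (fun k => match k with O => 0 | _ => c k end)
    (seq_const (c O))).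
  - apply entire_add; [|apply entire_const].
    apply entire_le with (2 := H); intros [|n]; [rewrite Rabs_R0; apply Rabs_pos|].
    unfold theta; rewrite Rabs_mult, (Rabs_pos_eq (INR (S n))) by apply pos_INR.
    assert (P := pos_INR n); rewrite S_INR. assert (Q := Rabs_pos (c (S n))). nra.
  - apply functional_extensionality; intros [|n]; unfold seq_add; simpl; ring.
Qed.

Lemma bessel_coef_neq_0 al k : non_negint al -> bessel_coef al k <> 0.
Proof.
  intros H; apply Rinv_neq_0_compat, Rmult_integral_contrapositive; split;
    [apply INR_fact_neq_0|apply poch_neq_0; auto].
Qed.

(** Ratio test: consecutive coefficients have ratio 1 / ((n + 1)(n + 1 + al)), which tends to 0. *)
Lemma entire_bessel_coef al : non_negint al -> entire (bessel_coef al).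
Proof.
  intros H.
  assert (CV : CV_radius (bessel_coef al) = p_infty).
  { apply CV_radius_infinite_DAlembert; [intros n; now apply bessel_coef_neq_0|].
    apply is_lim_seq_ext with (fun n => Rabs (/ (INR (S n) * (INR (S n) + al)))).
    - intros n; f_equal. rewrite <- (bessel_coef_S al n H).
      assert (B := bessel_coef_neq_0 al (S n) H).
      assert (H1 : INR (S n) <> 0) by (apply not_0_INR; lia).
      assert (H2 := H n). rewrite S_INR in *. field; repeat split; auto; lra.
    - replace (Finite 0) with (Rbar_abs (Rbar_inv (Rbar_mult p_infty p_infty)))
        by (simpl; now rewrite Rabs_R0).
      apply is_lim_seq_abs, is_lim_seq_inv; [|easy].
      apply is_lim_seq_mult with p_infty p_infty; [| |reflexivity].
      + apply (is_lim_seq_incr_1 INR), is_lim_seq_INR.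
      + apply is_lim_seq_plus with p_infty al; [|apply is_lim_seq_const|reflexivity].
        apply (is_lim_seq_incr_1 INR), is_lim_seq_INR. }
  intros r Hr; apply ex_series_Rext with (fun n => Rabs (bessel_coef al n * r ^ n)).
  - intros n; now rewrite Rabs_mult, (Rabs_pos_eq (r ^ n)) by (now apply pow_le).
  - apply CV_disk_inside; now rewrite CV.
Qed.

(** As the coefficients are real, the components are real series weighted by Re t^k and Im t^k, so
    convergence is only ever discussed over the reals. *)
Definition seval (a : nat -> R) (t : C) : C := CSeries (fun k => (RtoC (a k) * t ^ k)%C).

Lemma seval_eq a t : seval a t
  = (Series (fun k => a k * Re (t ^ k)%C), Series (fun k => a k * Im (t ^ k)%C)).
Proof.
  unfold seval, CSeries; f_equal; apply Series_ext; intros k;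
    [apply re_scal_l|apply im_scal_l].
Qed.

Lemma Rabs_Re_pow t k : Rabs (Re (t ^ k)%C) <= Cmod t ^ k.
Proof. rewrite <- Cmod_pow; apply re_le_Cmod. Qed.

Lemma Rabs_Im_pow t k : Rabs (Im (t ^ k)%C) <= Cmod t ^ k.
Proof.
  rewrite <- Cmod_pow; apply Rle_trans with (2 := Rmax_Cmod _); apply Rmax_r.
Qed.

Lemma entire_ex_series a (p : nat -> R) r : 0 <= r -> (forall k, Rabs (p k) <= r ^ k) ->
  entire a -> ex_series (fun k => Rabs (a k * p k)).
Proof.
  intros Hr Hp Ha; apply ex_series_Rle with (2 := Ha r Hr); intros n.
  rewrite Rabs_Rabsolu, Rabs_mult; apply Rmult_le_compat_l; [apply Rabs_pos|apply Hp].
Qed.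

Lemma ex_series_Re a t : entire a -> ex_series (fun k => Rabs (a k * Re (t ^ k)%C)).
Proof.
  intros Ha; apply entire_ex_series with (Cmod t); auto using Cmod_ge_0, Rabs_Re_pow.
Qed.

Lemma ex_series_Im a t : entire a -> ex_series (fun k => Rabs (a k * Im (t ^ k)%C)).
Proof.
  intros Ha; apply entire_ex_series with (Cmod t); auto using Cmod_ge_0, Rabs_Im_pow.
Qed.

Lemma seval_add a b t : entire a -> entire b ->
  seval (seq_add a b) t = (seval a t + seval b t)%C.
Proof.
  intros Ha Hb; rewrite !seval_eq; unfold Cplus; simpl.
  f_equal; rewrite <- Series_plus
    by (apply ex_series_Rabs; auto using ex_series_Re, ex_series_Im);
    apply Series_ext; intros n; unfold seq_add; ring.
Qed.

Lemma seval_scal c a t : seval (fun k => c * a k) t = (RtoC c * seval a t)%C.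
Proof.
  rewrite !seval_eq; unfold Cmult, RtoC; simpl.
  rewrite !Rmult_0_l, Rminus_0_r, Rplus_0_r.
  f_equal; rewrite <- Series_scal_l; apply Series_ext; intros n; ring.
Qed.

Lemma seval_sub a b t : entire a -> entire b ->
  seval (seq_sub a b) t = (seval a t - seval b t)%C.
Proof.
  intros Ha Hb; replace (seq_sub a b) with (seq_add a (fun k => -1 * b k)).
  - rewrite seval_add, seval_scal by (auto using entire_scal).
    replace (RtoC (-1)) with (- RtoC 1)%C by (rewrite <- RtoC_opp; reflexivity). ring.
  - apply functional_extensionality; intros n; unfold seq_add, seq_sub; ring.
Qed.

Lemma seval_rec a t : entire a -> seval a t = (RtoC (a O) + t * seval (shift a) t)%C.
Proof.
  intros Ha; assert (Hs := entire_shift a Ha).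
  assert (eR := ex_series_Rabs _ (ex_series_Re _ t Hs)).
  assert (eI := ex_series_Rabs _ (ex_series_Im _ t Hs)).
  rewrite !seval_eq; unfold Cplus, Cmult, RtoC; simpl fst; simpl snd.
  change (fst t) with (Re t); change (snd t) with (Im t).
  f_equal; rewrite Series_incr_1
    by (apply ex_series_Rabs; auto using ex_series_Re, ex_series_Im).
  - rewrite <- !Series_scal_l, <- Series_minus
      by (apply (ex_series_scal (V := R_NormedModule)); assumption).
    f_equal; [simpl; ring|apply Series_ext; intros n].
    rewrite Cpow_S, re_mult; unfold shift; ring.
  - rewrite <- !Series_scal_l, <- Series_plus
      by (apply (ex_series_scal (V := R_NormedModule)); assumption).
    f_equal; [simpl; ring|apply Series_ext; intros n].
    rewrite Cpow_S, im_mult; unfold shift; ring.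
Qed.

Lemma seval_const c t : seval (seq_const c) t = RtoC c.
Proof.
  rewrite seval_rec by apply entire_const.
  replace (shift (seq_const c)) with (fun k => 0 * seq_const c k)
    by (apply functional_extensionality; intros k; unfold shift; simpl; ring).
  rewrite seval_scal; simpl; ring.
Qed.

(** The complex product expands into four Cauchy products of absolutely convergent real series; they
    recombine through t^n = t^k t^(n-k). *)
Lemma seval_conv a b t : entire a -> entire b ->
  seval (conv a b) t = (seval a t * seval b t)%C.
Proof.
  intros Ha Hb.
  assert (aR := ex_series_Re a t Ha); assert (aI := ex_series_Im a t Ha).
  assert (bR := ex_series_Re b t Hb); assert (bI := ex_series_Im b t Hb).
  assert (M := fun p q (hp : ex_series (fun k => Rabs (p k)))
      (hq : ex_series (fun k => Rabs (q k))) =>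
    is_series_mult p q _ _ (Series_correct _ (ex_series_Rabs _ hp))
      (Series_correct _ (ex_series_Rabs _ hq)) hp hq).
  rewrite !seval_eq; unfold Cmult; simpl fst; simpl snd; f_equal.
  - rewrite <- (is_series_unique _ _ (M _ _ aR bR)), <- (is_series_unique _ _ (M _ _ aI bI)).
    rewrite <- Series_minus
      by first [exact (ex_intro _ _ (M _ _ aR bR))|exact (ex_intro _ _ (M _ _ aI bI))].
    apply Series_ext; intros n; rewrite conv_PS_mult; unfold PS_mult.
    rewrite <- minus_sum, Rmult_comm, scal_sum; apply sum_eq; intros k Hk.
    replace (t ^ n)%C with (t ^ k * t ^ (n - k))%C
      by (rewrite <- Cpow_add_r; f_equal; lia).
    rewrite re_mult; ring.
  - rewrite <- (is_series_unique _ _ (M _ _ aR bI)), <- (is_series_unique _ _ (M _ _ aI bR)).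
    rewrite <- Series_plus
      by first [exact (ex_intro _ _ (M _ _ aR bI))|exact (ex_intro _ _ (M _ _ aI bR))].
    apply Series_ext; intros n; rewrite conv_PS_mult; unfold PS_mult.
    rewrite <- plus_sum, Rmult_comm, scal_sum; apply sum_eq; intros k Hk.
    replace (t ^ n)%C with (t ^ k * t ^ (n - k))%C
      by (rewrite <- Cpow_add_r; f_equal; lia).
    rewrite im_mult; ring.
Qed.

(** * Termwise differentiation of the Bessel series in the order *)

Lemma poch_ge_1 x k : 1 <= x -> 1 <= poch x k.
Proof.
  intros Hx; induction k as [|k IH]; simpl; [lra|]. assert (H := pos_INR k); nra.
Qed.

Lemma harm_bounds x k : 1 <= x -> 0 <= harm x k <= INR k.
Proof.
  intros Hx; induction k as [|k IH]; [simpl; lra|].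
  rewrite S_INR; simpl. assert (H := pos_INR k).
  assert (0 < / (x + INR k)) by (apply Rinv_0_lt_compat; lra).
  assert (/ (x + INR k) <= 1) by (rewrite <- Rinv_1; apply Rinv_le_contravar; lra). lra.
Qed.

(** The actual derivative of the coefficient in the order. It differs from [dbessel_coef] by the
    summand 1/mu of the harmonic sum. *)
Definition bessel_coef_dnu (mu : R) (k : nat) : R := - (bessel_coef mu k * harm (mu + 1) k).

Lemma is_derive_bessel_coef mu k : 0 < mu ->
  is_derive (fun y => bessel_coef y k) mu (bessel_coef_dnu mu k).
Proof.
  intros Hmu; unfold bessel_coef_dnu, bessel_coef.
  assert (P := poch_pos (mu + 1) k ltac:(lra)); assert (F := INR_fact_lt_0 k).
  evar_last.
  - apply (is_derive_inv (fun y => INR (fact k) * poch (y + 1) k)).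
    + apply (is_derive_scal (fun y => poch (y + 1) k)).
      apply (is_derive_comp (V := R_NormedModule) (fun y => poch y k) (fun y => y + 1)).
      * apply is_derive_poch; lra.
      * apply (is_derive_plus (V := R_NormedModule) (fun y => y));
          [apply is_derive_id|apply is_derive_const].
    + apply Rmult_integral_contrapositive; split; lra.
  - unfold scal, plus, one, zero; simpl; unfold mult; simpl. field; lra.
Qed.

(** The bound is free of mu, so by the mean value theorem it is a Lipschitz constant of the k-th
    coefficient on the whole half-line. *)
Lemma bessel_coef_dnu_bound mu k : 0 < mu ->
  Rabs (bessel_coef_dnu mu k) <= INR k / INR (fact k).
Proof.
  intros Hmu; unfold bessel_coef_dnu, bessel_coef.
  assert (P := poch_ge_1 (mu + 1) k ltac:(lra)); assert (F := INR_fact_lt_0 k).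
  assert (H := harm_bounds (mu + 1) k ltac:(lra)).
  assert (I : 0 < / poch (mu + 1) k <= 1).
  { split; [apply Rinv_0_lt_compat; lra|].
    rewrite <- Rinv_1 at 2; apply Rinv_le_contravar; lra. }
  assert (J : 0 < / INR (fact k)) by (now apply Rinv_0_lt_compat).
  rewrite Rabs_Ropp, Rinv_mult, Rabs_pos_eq
    by (apply Rmult_le_pos; [apply Rmult_le_pos|]; lra).
  unfold Rdiv; rewrite (Rmult_comm (INR k)), Rmult_assoc.
  apply Rmult_le_compat_l; [lra|]. nra.
Qed.

Lemma bessel_coef_lipschitz x y k : 0 < x -> 0 < y ->
  Rabs (bessel_coef y k - bessel_coef x k) <= INR k / INR (fact k) * Rabs (y - x).
Proof.
  intros Hx Hy.
  assert (Hm : 0 < Rmin x y) by (now apply Rmin_pos).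
  destruct (MVT_gen (fun u => bessel_coef u k) x y (fun u => bessel_coef_dnu u k))
    as (c & Hc & E).
  - intros u Hu; apply is_derive_bessel_coef; lra.
  - intros u Hu; apply continuity_pt_filterlim.
    apply (ex_derive_continuous (V := R_NormedModule) (fun u => bessel_coef u k)).
    eexists; apply is_derive_bessel_coef; lra.
  - rewrite E, Rabs_mult. apply Rmult_le_compat_r; [apply Rabs_pos|].
    apply bessel_coef_dnu_bound; lra.
Qed.

Lemma entire_index_div_fact : entire (fun k => INR k / INR (fact k)).
Proof.
  intros r Hr; apply ex_series_incr_1.
  apply ex_series_Rext with (fun k => r * (/ INR (fact k) * r ^ k)).
  - intros n. change (fact (S n)) with (S n * fact n)%nat; rewrite mult_INR.
    assert (H1 : INR (S n) <> 0) by (apply not_0_INR; lia).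
    assert (F := INR_fact_lt_0 n).
    replace (INR (S n) / (INR (S n) * INR (fact n))) with (/ INR (fact n))
      by (field; split; lra || exact H1).
    rewrite Rabs_pos_eq by (left; now apply Rinv_0_lt_compat). simpl; ring.
  - apply (ex_series_scal (V := R_NormedModule) r).
    exists (exp r). apply is_pseries_R, is_exp_Reals.
Qed.

Lemma entire_bessel_coef_dnu nu : 0 < nu -> entire (bessel_coef_dnu nu).
Proof.
  intros Hn; apply entire_le with (2 := entire_index_div_fact); intros k.
  apply Rle_trans with (2 := Rle_abs _); now apply bessel_coef_dnu_bound.
Qed.

Lemma is_lim_seq_partial_sums (a : nat -> R) : ex_series a ->
  is_lim_seq (sum_f_R0 a) (Series a).
Proof.
  intros H; apply is_lim_seq_ext with (sum_n a); [intros n; apply sum_n_Reals|].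
  exact (Series_correct a H).
Qed.

Lemma is_derive_sum_f_R0 (f : nat -> R -> R) (df : nat -> R) x n :
  (forall k, is_derive (f k) x (df k)) ->
  is_derive (fun y => sum_f_R0 (fun k => f k y) n) x (sum_f_R0 df n).
Proof.
  intros H; induction n as [|n IH]; simpl; [apply H|].
  now apply (is_derive_plus (V := R_NormedModule) (fun y => sum_f_R0 (fun k => f k y) n)).
Qed.

(** The partial sums are the approximants. The increment of the remainder is at most |y - nu| times
    a tail of the majorant [M], a convergent series. The weight p stands for Re t^k or Im t^k. *)
Lemma is_derive_bessel_series (p : nat -> R) r nu : 0 < nu -> 0 <= r ->
  (forall k, Rabs (p k) <= r ^ k) ->
  is_derive (fun y => Series (fun k => bessel_coef y k * p k)) nu
    (Series (fun k => bessel_coef_dnu nu k * p k)).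
Proof.
  intros Hnu Hr Hp.
  set (M := fun k => INR k / INR (fact k) * r ^ k).
  assert (HM : ex_series M).
  { apply ex_series_Rext with (2 := entire_index_div_fact r Hr); intros n.
    rewrite Rabs_pos_eq; [reflexivity|].
    apply Rdiv_le_0_compat; [apply pos_INR|apply INR_fact_lt_0]. }
  assert (nn : forall y, 0 < y -> non_negint y)
    by (intros y Hy n; assert (H := pos_INR n); lra).
  assert (Hex : forall y, 0 < y -> ex_series (fun k => bessel_coef y k * p k)).
  { intros y Hy; apply ex_series_Rabs, entire_ex_series with r; auto.
    now apply entire_bessel_coef, nn. }
  apply is_derive_of_approx
    with (phi := fun n y => sum_f_R0 (fun k => bessel_coef y k * p k) n)
         (dphi := sum_f_R0 (fun k => bessel_coef_dnu nu k * p k))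
         (eps := fun n => Series (fun k => M (S n + k)%nat)).
  - intros n; apply (is_derive_sum_f_R0 (fun k y => bessel_coef y k * p k)).
    intros k; apply (is_derive_scal_l (V := R_NormedModule) (fun y => bessel_coef y k)).
    now apply is_derive_bessel_coef.
  - apply is_lim_seq_ext with (fun n => Series M - sum_f_R0 M n).
    + intros n; rewrite (Series_incr_n M (S n)) by (auto; lia). simpl Nat.pred; ring.
    + replace (Finite 0) with (Finite (Series M - Series M)) by (f_equal; ring).
      apply is_lim_seq_minus'; [apply is_lim_seq_const|now apply is_lim_seq_partial_sums].
  - intros n; apply filter_imp with (2 := locally_pos nu Hnu); intros y Hy.
    rewrite (Series_incr_n (fun k => bessel_coef y k * p k) (S n)) by (auto; lia).
    rewrite (Series_incr_n (fun k => bessel_coef nu k * p k) (S n)) by (auto; lia).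
    simpl Nat.pred.
    set (Ty := fun k => bessel_coef y (S n + k) * p (S n + k)%nat).
    set (Tn := fun k => bessel_coef nu (S n + k) * p (S n + k)%nat).
    replace (sum_f_R0 (fun k => bessel_coef y k * p k) n + Series Ty -
      (sum_f_R0 (fun k => bessel_coef nu k * p k) n + Series Tn) -
      (sum_f_R0 (fun k => bessel_coef y k * p k) n
        - sum_f_R0 (fun k => bessel_coef nu k * p k) n))
      with (Series Ty - Series Tn) by ring.
    assert (tail : forall f, ex_series f -> ex_series (fun k => f (S n + k)%nat))
      by (intros f Hf; now apply (ex_series_incr_n (V := R_NormedModule) f (S n))).
    assert (B : forall k, Rabs (Ty k - Tn k) <= M (S n + k)%nat * Rabs (y - nu)).
    { intros k; unfold Ty, Tn, M. rewrite <- Rmult_minus_distr_r, Rabs_mult.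
      apply Rle_trans with (INR (S n + k) / INR (fact (S n + k)) * Rabs (y - nu)
        * r ^ (S n + k)); [|right; ring].
      apply Rmult_le_compat; try apply Rabs_pos; [now apply bessel_coef_lipschitz|apply Hp]. }
    assert (HB : ex_series (fun k => M (S n + k)%nat * Rabs (y - nu))).
    { apply (ex_series_scal_r (Rabs (y - nu))), tail, HM. }
    rewrite <- Series_minus
      by first [exact (tail _ (Hex y Hy))|exact (tail _ (Hex nu Hnu))].
    rewrite <- Series_scal_r.
    apply Rle_trans with (Series (fun k => Rabs (Ty k - Tn k))).
    + apply Series_Rabs. apply ex_series_Rle with (2 := HB); intros k.
      rewrite Rabs_Rabsolu; apply B.
    + apply Series_le; [|exact HB]. intros k; split; [apply Rabs_pos|apply B].
  - apply is_lim_seq_partial_sums, ex_series_Rabs, entire_ex_series with r; auto.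
    now apply entire_bessel_coef_dnu.
Qed.

(** * Complex-valued functions of a real variable *)

Definition is_derive_RC (f : R -> C) (x : R) (l : C) : Prop :=
  is_derive (fun y => Re (f y)) x (Re l) /\ is_derive (fun y => Im (f y)) x (Im l).

(** f is written as a real combination of the fixed vectors 1 and i, so linearity of the derivative
    suffices. *)
Lemma is_derive_RC_correct f x l : is_derive_RC f x l ->
  @is_derive R_AbsRing C_R_NormedModule f x l.
Proof.
  intros [H1 H2].
  apply (is_derive_ext (V := C_R_NormedModule)
    (fun y => plus (scal (Re (f y)) (1, 0) : C_R_NormedModule)
                   (scal (Im (f y)) (0, 1) : C_R_NormedModule))).
  - intros y; rewrite (surjective_pairing (f y)).
    unfold plus, scal; simpl; unfold prod_plus, prod_scal, plus, scal; simpl.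
    unfold mult; simpl; f_equal; ring.
  - replace l with (plus (scal (Re l) (1, 0) : C_R_NormedModule)
                   (scal (Im l) (0, 1) : C_R_NormedModule)).
    + apply (is_derive_plus (V := C_R_NormedModule));
        [exact (is_derive_scal_l (V := C_R_NormedModule) (fun y => Re (f y)) x _ (1, 0) H1)
        |exact (is_derive_scal_l (V := C_R_NormedModule) (fun y => Im (f y)) x _ (0, 1) H2)].
    + rewrite (surjective_pairing l).
      unfold plus, scal; simpl; unfold prod_plus, prod_scal, plus, scal; simpl.
      unfold mult; simpl; f_equal; ring.
Qed.

Lemma is_derive_RC_ext_loc f g x l : locally x (fun y => f y = g y) ->
  is_derive_RC f x l -> is_derive_RC g x l.
Proof.
  intros H [H1 H2]; split; [apply is_derive_ext_loc with (2 := H1)|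
    apply is_derive_ext_loc with (2 := H2)];
    apply filter_imp with (2 := H); intros y E; now rewrite E.
Qed.

Lemma is_derive_RC_mult f g x lf lg : is_derive_RC f x lf -> is_derive_RC g x lg ->
  is_derive_RC (fun y => (f y * g y)%C) x (lf * g x + f x * lg)%C.
Proof.
  intros [f1 f2] [g1 g2].
  assert (M := fun u v lu lv (hu : is_derive u x lu) (hv : is_derive v x lv) =>
    is_derive_mult u v x lu lv hu hv Rmult_comm).
  split.
  - apply is_derive_ext with (fun y => minus (mult (Re (f y)) (Re (g y)))
      (mult (Im (f y)) (Im (g y)))); [intros y; symmetry; apply re_mult|].
    evar_last; [apply (is_derive_minus (V := R_NormedModule)); apply M; eassumption|].
    rewrite re_plus, !re_mult; unfold minus, plus, opp, mult; simpl; ring.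
  - apply is_derive_ext with (fun y => plus (mult (Re (f y)) (Im (g y)))
      (mult (Im (f y)) (Re (g y)))); [intros y; symmetry; apply im_mult|].
    evar_last; [apply (is_derive_plus (V := R_NormedModule)); apply M; eassumption|].
    rewrite im_plus, !im_mult; unfold plus, mult; simpl; ring.
Qed.

Lemma is_derive_RC_RtoC g x l : is_derive g x l ->
  is_derive_RC (fun y => RtoC (g y)) x (RtoC l).
Proof.
  intros H; split; simpl; [exact H|].
  exact (is_derive_const (V := R_NormedModule) (0 : R) x).
Qed.

Lemma is_derive_RC_Cpower w x :
  is_derive_RC (fun y => Cpower w (RtoC y)) x (Cpower w (RtoC x) * Clog w)%C.
Proof.
  unfold Cpower, Cexp, Cmult, RtoC; destruct (Clog w) as [u v]; split; simpl;
    auto_derive; auto; unfold Rminus; ring.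
Qed.

Lemma is_derive_RC_seval_bessel_coef nu t : 0 < nu ->
  is_derive_RC (fun y => seval (bessel_coef y) t) nu (seval (bessel_coef_dnu nu) t).
Proof.
  intros Hn; rewrite seval_eq; split.
  - apply is_derive_ext with (fun y => Series (fun k => bessel_coef y k * Re (t ^ k)%C)).
    + intros y; now rewrite seval_eq.
    + apply is_derive_bessel_series with (Cmod t); auto using Cmod_ge_0, Rabs_Re_pow.
  - apply is_derive_ext with (fun y => Series (fun k => bessel_coef y k * Im (t ^ k)%C)).
    + intros y; now rewrite seval_eq.
    + apply is_derive_bessel_series with (Cmod t); auto using Cmod_ge_0, Rabs_Im_pow.
Qed.

(** * Bessel and hypergeometric functions as entire series in (z/2)^2 *)

Lemma BesselI_eq mu z : non_negint mu -> Gamma (mu + 1) <> 0 ->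
  BesselI mu z = (Cpower (z / 2) mu
    * (RtoC (/ Gamma (mu + 1)) * seval (bessel_coef mu) ((z / 2) ^ 2)))%C.
Proof.
  intros H HG; unfold BesselI; generalize (z / 2)%C; intros w; f_equal. rewrite <- seval_scal.
  unfold seval; f_equal; apply functional_extensionality; intros k.
  replace (mu + INR k + 1) with (mu + 1 + INR k) by ring.
  assert (P : poch (mu + 1) k <> 0) by (apply poch_neq_0; auto).
  rewrite Gamma_poch by (intros; apply H).
  assert (F := INR_fact_neq_0 k).
  unfold Cdiv; rewrite Cpow_mult_r, <- RtoC_inv
    by (apply Rmult_integral_contrapositive; split; [assumption|];
        apply Rmult_integral_contrapositive; split; assumption).
  rewrite Cmult_comm; apply (f_equal (fun x => RtoC x * _)%C).
  unfold bessel_coef; field; repeat split; assumption.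
Qed.

Lemma Cpower_add w s1 s2 : (Cpower w s1 * Cpower w s2)%C = Cpower w (s1 + s2)%C.
Proof.
  unfold Cpower; rewrite Cmult_plus_distr_r.
  destruct (s1 * Clog w)%C as [a b], (s2 * Clog w)%C as [c d].
  unfold Cexp, Cplus, Cmult; simpl; rewrite exp_plus, cos_plus, sin_plus; f_equal; ring.
Qed.

Lemma Cpow_4_quarter z k : ((z ^ 2) ^ k = RtoC (4 ^ k) * ((z / 2) ^ 2) ^ k)%C.
Proof.
  rewrite RtoC_pow, <- Cpow_mult_l; f_equal.
  replace (RtoC 4) with (2 * 2)%C by (rewrite <- RtoC_mult; f_equal; ring).
  field.
Qed.

Lemma hypergeom_seval a b z :
  hypergeom a b (z ^ 2)%C
  = seval (fun k => 4 ^ k * (poch_prod a k / poch_prod b k / INR (fact k))) ((z / 2) ^ 2)%C.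
Proof.
  unfold hypergeom, seval; f_equal; apply functional_extensionality; intros k.
  rewrite Cpow_4_quarter; generalize (poch_prod a k / poch_prod b k); intros q.
  unfold Rdiv; rewrite !RtoC_mult, RtoC_inv by apply INR_fact_neq_0.
  unfold Cdiv; ring.
Qed.

Lemma entire_F34_coef nu : non_negint nu -> non_negint (- nu) -> entire (F34_coef nu).
Proof.
  intros Ha Hb; apply entire_of_theta; rewrite theta_F34_coef by assumption.
  apply entire_conv; [apply entire_const|apply entire_sub; [|apply entire_const]].
  apply entire_conv; now apply entire_bessel_coef.
Qed.

(** Solving (theta + nu) d = nu a^2 coefficientwise, those of d are nu / (n + nu) <= 1 times those
    of a^2. *)
Lemma entire_F23_coef nu : 0 < nu -> entire (F23_coef nu).
Proof.
  intros Hn; assert (Ha : non_negint nu) by (intros n; assert (H := pos_INR n); lra).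
  apply entire_le with (b := conv (bessel_coef nu) (bessel_coef nu)).
  - intros n; assert (E := f_equal (fun f => f n) (theta_F23_coef nu Hn)); simpl in E.
    unfold seq_sub in E; rewrite !conv_const_l in E; unfold theta in E.
    assert (P := pos_INR n).
    set (w := conv (bessel_coef nu) (bessel_coef nu) n) in *.
    replace (F23_coef nu n) with (nu / (INR n + nu) * w).
    + rewrite Rabs_mult; apply Rle_trans with (1 * Rabs w); [|lra].
      apply Rmult_le_compat_r; [apply Rabs_pos|].
      rewrite Rabs_pos_eq by (apply Rdiv_le_0_compat; lra).
      apply Rmult_le_reg_r with (INR n + nu); [lra|]. field_simplify; lra.
    + apply Rmult_eq_reg_l with (INR n + nu); [|lra]. field_simplify; lra.
  - apply entire_conv; now apply entire_bessel_coef.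
Qed.

(** The constant term of [F34_coef] is 0, so one factor t can be taken out; with 4 t = z^2 it
    becomes the prefactor. *)
Lemma hypergeom_F34 nu z : non_negint nu -> non_negint (- nu) ->
  (z ^ 2 / RtoC (4 * (1 - nu ^ 2))
    * hypergeom [1; 1; 3 / 2]%R [2; 2; 2 - nu; 2 + nu]%R (z ^ 2)
   = seval (F34_coef nu) ((z / 2) ^ 2))%C.
Proof.
  intros Ha Hb; rewrite seval_rec by (now apply entire_F34_coef).
  change (shift (F34_coef nu)) with (fun m => / (1 - nu ^ 2) * (4 ^ m
    * (poch_prod [1; 1; 3 / 2] m / poch_prod [2; 2; 2 - nu; 2 + nu] m / INR (fact m)))).
  rewrite seval_scal, <- hypergeom_seval; simpl (F34_coef nu 0).
  assert (H : 1 - nu ^ 2 <> 0).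
  { replace (1 - nu ^ 2) with ((nu + 1 + 0) * (- nu + 1 + 0)) by ring.
    apply Rmult_integral_contrapositive; split; [apply (Ha O)|apply (Hb O)]. }
  replace (z ^ 2)%C with (4 * (z / 2) ^ 2)%C at 1.
  - rewrite RtoC_mult, RtoC_inv by assumption. field.
    intros E; apply RtoC_inj in E; contradiction.
  - assert (E := Cpow_4_quarter z 1); rewrite !Cpow_1_r, pow_1 in E; now symmetry.
Qed.

(** * Derivative of the Bessel function in the order *)

Theorem mainTheorem3 (nu : R) (hnu : 0 < nu)
  (hnuZ : forall n : Z, nu <> IZR n)
  (z : C) (hz : z <> RtoC 0) (harg : Rabs (Arg z) < PI) :
  @is_derive R_AbsRing C_R_NormedModule (fun mu : R => BesselI mu z) nu
    (BesselI nu z *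
       (z ^ 2 / RtoC (4 * (1 - nu ^ 2)) *
          hypergeom [1; 1; 3 / 2]%R [2; 2; 2 - nu; 2 + nu]%R (z ^ 2)
        + Clog (z / 2) - RtoC (digamma nu) - RtoC (1 / (2 * nu)))
     - BesselI (- nu) z *
         RtoC (PI * / sin (PI * nu) / (2 * Gamma (nu + 1) ^ 2)) *
         Cpower (z / 2) (RtoC (2 * nu)) *
         hypergeom [nu; 1 / 2 + nu]%R [1 + nu; 1 + nu; 1 + 2 * nu]%R (z ^ 2))%C.
Proof.
  assert (HPI := PI_RGT_0).
  assert (nn : forall y, 0 < y -> non_negint y)
    by (intros y Hy n; assert (H := pos_INR n); lra).
  assert (Ha := nn nu hnu).
  assert (Hb : non_negint (- nu)).
  { intros n E; apply (hnuZ (Z.of_nat (S n))).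
    rewrite <- INR_IZR_INZ, S_INR; lra. }
  assert (Rf := Gamma_reflection nu hnu hnuZ).
  assert (G0 := Gamma_pos nu hnu); assert (G1 := Gamma_S nu ltac:(lra)).
  (* No factor of the reflection formula can vanish, since their product is PI. *)
  assert (Hs : sin (PI * nu) <> 0) by (intros E; rewrite E in Rf; lra).
  assert (Gm : Gamma (1 - nu) <> 0) by (intros E; rewrite E in Rf; lra).
  assert (Gm' : Gamma (- nu + 1) <> 0) by (now rewrite Rplus_comm).
  assert (Gp : Gamma (nu + 1) <> 0) by (rewrite G1; nra).
  set (t := ((z / 2) ^ 2)%C).
  apply is_derive_RC_correct.
  apply is_derive_RC_ext_loc with (f := fun y : R => (Cpower (z / 2) y
    * (RtoC (/ Gamma (y + 1)) * seval (bessel_coef y) t))%C).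
  { apply filter_imp with (2 := locally_pos nu hnu); intros y Hy.
    symmetry; apply BesselI_eq; [now apply nn|].
    assert (P := Gamma_pos (y + 1) ltac:(lra)); lra. }
  (* Differentiating y Gamma(y) instead brings in psi at nu rather than at nu + 1, at the price of a
     summand 1/nu. *)
  assert (DG : is_derive (fun y => Gamma (y + 1)) nu (Gamma nu + nu * Derive Gamma nu)).
  { apply is_derive_ext_loc with (fun y => y * Gamma y).
    - apply filter_imp with (2 := locally_pos nu hnu); intros y Hy.
      symmetry; apply Gamma_S; lra.
    - evar_last.
      + apply (is_derive_mult (fun y => y) Gamma); [apply is_derive_id| |apply Rmult_comm].
        apply Derive_correct; now apply ex_derive_Gamma.
      + unfold plus, mult, one; simpl; ring. }
  assert (D := is_derive_RC_mult _ _ _ _ _ (is_derive_RC_Cpower (z / 2) nu)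
    (is_derive_RC_mult _ _ _ _ _
      (is_derive_RC_RtoC _ _ _ (is_derive_inv _ _ _ DG Gp))
      (is_derive_RC_seval_bessel_coef nu t hnu))).
  (* The product rule has given a derivative; what remains is an equality of complex numbers. *)
  match type of D with is_derive_RC _ _ ?l => match goal with |- is_derive_RC _ _ ?l' =>
    replace l' with l; [exact D|clear D] end end.
  rewrite hypergeom_F34, hypergeom_seval, !BesselI_eq by assumption; fold t.
  change (fun k => 4 ^ k * _) with (F23_coef nu).
  assert (Ea := entire_bessel_coef nu Ha); assert (Eb := entire_bessel_coef (- nu) Hb).
  assert (Ec := entire_F34_coef nu Ha Hb); assert (Ed := entire_F23_coef nu hnu).
  assert (Edn := entire_bessel_coef_dnu nu hnu).
  assert (U : seval (dbessel_coef nu) t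
    = (seval (bessel_coef_dnu nu) t - RtoC (/ nu) * seval (bessel_coef nu) t)%C).
  { rewrite <- seval_scal, <- seval_sub by (auto using entire_scal).
    f_equal; apply functional_extensionality; intros k.
    unfold seq_sub, dbessel_coef, bessel_coef_dnu.
    replace (harm nu (S k)) with (/ nu + harm (nu + 1) k); [ring|].
    induction k as [|k IH]; [simpl; rewrite !Rplus_0_r; ring|].
    change (harm nu (S (S k))) with (harm nu (S k) + / (nu + INR (S k))).
    rewrite <- IH, S_INR; cbn [harm].
    replace (nu + 1 + INR k) with (nu + (INR k + 1)) by ring. ring. }
  rewrite dbessel_coef_eq, seval_sub, !seval_conv, seval_sub, !seval_const in U
    by (auto using entire_conv, entire_sub, entire_const).
  (* Every term now carries the same two powers of z/2, which [ring] treats as atoms. *)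
  replace (Cpower (z / 2) nu) with (Cpower (z / 2) (- nu)%R * Cpower (z / 2) (2 * nu)%R)%C
    by (rewrite Cpower_add, <- RtoC_plus; do 2 f_equal; ring).
  replace (- (Gamma nu + nu * Derive Gamma nu) / Gamma (nu + 1) ^ 2)
    with (- / Gamma (nu + 1) * (/ nu + digamma nu))
    by (unfold digamma; rewrite G1; field; lra).
  (* By reflection PI / (sin(PI nu) Gamma(1 - nu)) = Gamma(nu), and Gamma(nu + 1) = nu Gamma(nu). So
     the prefactor of the 2F3 term agrees with the coefficient 1/(2 nu) of b d. *)
  assert (K : / Gamma (- nu + 1) * (PI * / sin (PI * nu) / (2 * Gamma (nu + 1) ^ 2))
    = / Gamma (nu + 1) * / (2 * nu)).
  { replace (- nu + 1) with (1 - nu) by ring. rewrite G1.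
    generalize dependent (sin (PI * nu)); intros s Rf Hs; rewrite <- Rf. field; repeat split; auto; lra. }
  apply (f_equal RtoC) in K; rewrite !(RtoC_mult (/ _) _) in K.
  replace (1 / (2 * nu)) with (/ (2 * nu)) by (unfold Rdiv; ring).
  rewrite (RtoC_mult (- _)), RtoC_plus, (RtoC_opp (/ _)).
  (* Adding and subtracting a/nu makes [U] applicable; the added 1/nu cancels the one next to
     psi(nu), and -1/(2 nu) remains from the factor of a in [U]. *)
  replace (seval (bessel_coef_dnu nu) t)
    with (seval (bessel_coef_dnu nu) t - RtoC (/ nu) * seval (bessel_coef nu) t
      + RtoC (/ nu) * seval (bessel_coef nu) t)%C by ring.
  rewrite <- U.
  match goal with |- _ = (?m - ?cm * (?gm * ?b) * ?k * ?c2 * ?q)%C =>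
    transitivity (m - cm * b * c2 * q * (gm * k))%C; [rewrite K|]; ring end.
Qed.
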